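(* For an integer $n\ge 1$ let $Y_n$ denote the space of $C^\infty$-functions $f\colon[0,1]\to S^1$ with $\|f\|_{W^{1,1}}\le 1+\pi n$, equipped with the topology induced by the $L^1$-norm and with the $\mathbb{Z}/2$-action $f\mapsto -f$. Then $$n\le\mathrm{coind}\,Y_n\le 2n-1.$$
   Context: $S^{1}$ denotes the unit circle in $\mathbb{C}$. The $W^{1,1}$-norm is $\|f\|_{W^{1,1}}=\int_{0}^{1}|f(x)|\,dx+\int_{0}^{1}|f'(x)|\,dx$. The $L^1$-topology is the one given by the metric $(f,g)\mapsto\int_0^1|f(x)-g(x)|\,dx$. For a topological space $Z$ with a $\mathbb{Z}/2$-action generated by $\sigma\colon Z\to Z$, the $\mathbb{Z}/2$-coindex $\mathrm{coind}\,Z$ is the largest integer $m$ such that there is a continuous map $f\colon S^m\to Z$ with $f(-x)=\sigma(f(x))$ for all $x\in S^m$, where $S^m$ is the unit sphere in $\mathbb{R}^{m+1}$. *)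

(* Defs.v *)
From HB Require Import structures.
From mathcomp Require Import all_boot all_order all_algebra.
From mathcomp Require Import complex.
From mathcomp Require Import all_classical all_reals all_analysis.
Import numFieldNormedType.Exports.

Set Implicit Arguments.
Unset Strict Implicit.
Unset Printing Implicit Defensive.
Import Order.TTheory GRing.Theory Num.Theory.

Local Open Scope classical_set_scope.
Local Open Scope ring_scope.
Local Open Scope complex_scope.

(* 'rV carries the sup norm in the library, so the Euclidean sphere is given by
   its equation. *)
Definition sphere (R : realType) (m : nat) : set 'rV[R]_m.+1 :=
  [set x | \sum_(i < m.+1) x 0 i ^+ 2 = 1].
Arguments sphere : clear implicits.

Lemma sphereN (R : realType) m (x : sphere R m) : - val x \in sphere R m.
Proof.
case: x => x /= /set_mem xS; apply/mem_set; rewrite /sphere /=.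
by rewrite -[RHS]xS; apply: eq_bigr => i _; rewrite mxE sqrrN.
Qed.

Definition antipode (R : realType) m (x : sphere R m) : sphere R m :=
  SigSub (sphereN x).

Definition equivariant_from_sphere (R : realType) (Z : topologicalType)
    (sigma : Z -> Z) (m : nat) : Prop :=
  exists f : sphere R m -> Z,
    continuous f /\ forall x, f (antipode x) = sigma (f x).

(* Relational: the coindex need not exist for a general Z.  The only case lost
   by taking m in nat is the value -1 of the empty space. *)
Definition is_coind (R : realType) (Z : topologicalType) (sigma : Z -> Z)
    (m : nat) : Prop :=
  equivariant_from_sphere R sigma m /\
  forall k, equivariant_from_sphere R sigma k -> (k <= m)%N.
Arguments is_coind : clear implicits.

Lemma is_coind_unique (R : realType) (Z : topologicalType) (sigma : Z -> Z) m k :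
  is_coind R Z sigma m -> is_coind R Z sigma k -> m = k.
Proof.
move=> [fm mmax] [fk kmax]; apply/eqP.
by rewrite eqn_leq kmax//= mmax.
Qed.

(* R[i] with the topology of its modulus. *)
HB.instance Definition _ (R : rcfType) := NormedModule.copy R[i] R[i]^o.

Notation unit_interval R := (set_type (`[0, 1]%classic : set R)).

Section calculus_on_unit_interval.
Context {R : realType}.
Implicit Types f g : unit_interval R -> R[i].

Definition normC (z : R[i]) : R := ComplexField.Normc.normc z.

Definition diffquot f (t s : unit_interval R) : R[i] :=
  (f s - f t) / (val s - val t)%:C.

(* The filter t^' is taken in the subspace [0, 1], so these derivatives are
   one-sided at 0 and 1. *)
Definition derivable01 f :=
  forall t, cvg (diffquot f t s @[s --> t^']).

Definition deriv01 f (t : unit_interval R) : R[i] :=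
  lim (diffquot f t s @[s --> t^']).

Definition smooth01 f := forall k, derivable01 (iter k deriv01 f).

(* 'valL_0 extends a function on [0, 1] by 0 outside [0, 1]. *)
Definition L1norm f : \bar R :=
  (\int[lebesgue_measure]_(t in `[0%R, 1%R]) ('valL_0 (normC \o f) t)%:E)%E.

Definition W11norm f : \bar R := (L1norm f + L1norm (deriv01 f))%E.

End calculus_on_unit_interval.

Record Y (R : realType) (n : nat) := MkY {
  Yfun :> unit_interval R -> R[i] ;
  Y_circle : forall t, normC (Yfun t) = 1 ;
  Y_smooth : smooth01 Yfun ;
  Y_bound : (W11norm Yfun <= (1 + pi * n%:R)%:E)%E }.
Arguments Y_smooth {R n} y.

Section Y_metric.
Context {R : realType}.
Local Notation mu := (@lebesgue_measure R).
Local Notation I := (unit_interval R).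
Implicit Types f g h : I -> R[i].

Let ltc_normC (z : R[i]) (e : R) : (`|z| < e%:C) = (normC z < e).
Proof. by rewrite -[`|z|]/((normC z)%:C) ltcR. Qed.

Let normCB (z w : R[i]) : normC (z - w) = normC (w - z).
Proof. by rewrite -opprB; exact: normcN. Qed.

Let ler_normC_dist (z w : R[i]) : `|normC z - normC w| <= normC (z - w).
Proof.
have H (a b : R[i]) : normC a <= normC (a - b) + normC b.
  by rewrite -{1}(subrK b a); exact: le_normcD.
rewrite ler_norml lerNl opprB !lerBlDr (H z w) andbT.
by rewrite normCB; exact: H.
Qed.

Lemma continuous_normC (T : topologicalType) (f : T -> R[i]) :
  continuous f -> continuous (normC \o f : T -> R).
Proof.
move=> cf t; apply/cvgrPdist_lt => e e0.
have e0' : 0 < (e%:C : R[i]) by rewrite ltcR.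
have /cvgrPdist_lt /(_ _ e0') := cf t.
apply: filterS => s; rewrite ltc_normC => /(le_lt_trans _); apply.
exact: ler_normC_dist.
Qed.

Lemma unit_interval_nbhsP (t : I) (P : set I) :
  nbhs t P <-> exists2 e : R, 0 < e & forall s : I, `|val t - val s| < e -> P s.
Proof.
split=> [/(nbhs_ballP t)[e /= e0 eP]|[e e0 eP]].
  by exists e => // s ts; exact: eP.
by apply/(nbhs_ballP t); exists e => // s ts; exact: eP.
Qed.

Lemma dnbhs_unit_interval_proper (t : I) : ProperFilter t^'.
Proof.
apply: Build_ProperFilter_ex => P /unit_interval_nbhsP[e e0 eP].
suff [r rI [rt rte]] : exists2 r : R, r \in `[0, 1] & r != val t /\ `|val t - r| < e.
  have rA : r \in (`[0, 1]%classic : set R) by rewrite inE.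
  exists (SigSub rA); apply: eP => //=; apply: contra_neq rt => <-.
have /andP[t0 t1] : 0 <= val t <= 1.
  by have := set_valP t; rewrite /= in_itv/=.
have h0 : (0 : R) < 2^-1 by rewrite invr_gt0.
pose d := Num.min (e / 2) 2^-1.
have d0 : 0 < d by rewrite /d lt_min divr_gt0.
have de : d < e by rewrite /d gt_min ltr_pdivrMr// ltr_pMr// ltr1n.
have d2 : d <= 2^-1 by rewrite /d ge_min lexx orbT.
have h1 : 2^-1 + 2^-1 <= 1 :> R by rewrite [leRHS]splitr div1r.
have [t2|/ltW t2] := leP (val t) 2^-1.
  exists (val t + d).
    by rewrite in_itv/= addr_ge0 ?(ltW d0)//= (le_trans (lerD t2 d2)).
  by rewrite -subr_eq0 addrAC subrr add0r gt_eqF// opprD addNKr normrN gtr0_norm.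
exists (val t - d).
  by rewrite in_itv/= subr_ge0 (le_trans d2 t2) (le_trans _ t1)// gerBl ltW.
rewrite -subr_eq0 addrAC subrr add0r oppr_eq0 gt_eqF//.
by rewrite opprB addrC subrK gtr0_norm.
Qed.

Lemma derivable01_continuous f : derivable01 f -> continuous f.
Proof.
move=> df t.
have idC : (val s - val t)%:C @[s --> t^'] --> (0 : R[i]).
  apply/cvgrPdist_lt => e e0.
  have eE : e = (normC e)%:C by rewrite -[LHS]gtr0_norm.
  rewrite eE -[X in _ < X]/((normC e)%:C) in e0 *.
  rewrite ltcR in e0.
  apply: (@nbhs_dnbhs _ t); apply/unit_interval_nbhsP; exists (normC e) => // s.
  rewrite sub0r normrN ltc_normC.
  suff -> : normC ((val s - val t)%:C) = `|val t - val s| by [].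
  by rewrite /normC /= expr0n addr0 sqrtr_sqr distrC.
have dC : f s - f t @[s --> t^'] --> (0 : R[i]).
  have /cvgM := df t; move=> /(_ _ _ idC); rewrite mulr0.
  apply: cvg_trans; apply: near_eq_cvg.
  have : \forall s \near t^', s != t by exact: nbhs_dnbhs_neq.
  apply: filterS => s st /=.
  rewrite /diffquot divfK// fmorph_eq0.
  by rewrite subr_eq0 (inj_eq val_inj).
have dC' e : 0 < e -> \forall s \near t, s != t -> `|f t - f s| < e.
  have /cvgrPdist_lt/(_ e) := dC; move=> /[apply].
  by apply: filterS => s; rewrite sub0r opprB.
apply/(@cvgrPdist_lt _ R[i] _ _ (nbhs_filter t)) => e e0.
apply: filterS (dC' _ e0) => s; have [->|_] := eqVneq s t; last exact.
by rewrite subrr normr0.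
Qed.

Lemma smooth01_continuous f : smooth01 f -> continuous f.
Proof. by move=> /(_ 0%N)/derivable01_continuous. Qed.

Let diffquotN f t : diffquot (\- f) t = \- diffquot f t.
Proof. by apply/funext => s; rewrite /diffquot/= -opprD mulNr. Qed.

Lemma deriv01N f : derivable01 f -> deriv01 (\- f) = \- deriv01 f.
Proof.
move=> df; apply/funext => t; have tP := dnbhs_unit_interval_proper t.
apply/cvg_lim => //; rewrite diffquotN.
by apply: cvgN; exact: df.
Qed.

Let iter_deriv01N f k : smooth01 f ->
  iter k deriv01 (\- f) = \- iter k deriv01 f.
Proof. by move=> sf; elim: k => //= k ->; rewrite deriv01N. Qed.

Lemma smooth01N f : smooth01 f -> smooth01 (\- f).
Proof.
move=> sf k t; rewrite (iter_deriv01N _ sf) diffquotN.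
by apply: is_cvgN; exact: sf.
Qed.

Lemma L1normN f : L1norm (\- f) = L1norm f.
Proof.
rewrite /L1norm; suff -> : normC \o (\- f) = normC \o f :> (I -> R) by [].
by apply/funext => t; exact: normcN.
Qed.

Lemma W11normN f : derivable01 f -> W11norm (\- f) = W11norm f.
Proof. by move=> df; rewrite /W11norm deriv01N// !L1normN. Qed.

Let integrable_valL (u : I -> R) : continuous u ->
  mu.-integrable `[0, 1] (EFin \o 'valL_0 u).
Proof.
move=> cu; apply: continuous_compact_integrable; first exact: segment_compact.
exact/subspace_valL_continuousP'.
Qed.

Let integrable_normC f : continuous f ->
  mu.-integrable `[0, 1] (EFin \o 'valL_0 (normC \o f)).
Proof. by move=> /continuous_normC/integrable_valL. Qed.

Lemma L1norm_fin_num f : continuous f -> L1norm f \is a fin_num.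
Proof. by move=> /integrable_normC/integrable_fin_num; exact. Qed.

Let normC_ge0 (z : R[i]) : 0 <= normC z.
Proof. by case: z => a b; exact: sqrtr_ge0. Qed.

Let valL_normC_ge0 f x : 0 <= 'valL_0 (normC \o f) x.
Proof. by rewrite /valL_/=; case: ('oinv_set_val x) => //= a. Qed.

Lemma L1normD f g : continuous f -> continuous g ->
  (L1norm (f \+ g)%R <= L1norm f + L1norm g)%E.
Proof.
move=> cf cg; rewrite /L1norm -ge0_integralD//=; first last.
- exact: measurable_int (integrable_normC cg).
- by move=> x _; rewrite lee_fin; exact: valL_normC_ge0.
- exact: measurable_int (integrable_normC cf).
- by move=> x _; rewrite lee_fin; exact: valL_normC_ge0.
have cfg : continuous (f \+ g).
  by move=> t; exact: (cvgD (cf t) (cg t)).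
apply: ge0_le_integral => //=.
- by move=> x _; rewrite lee_fin; exact: valL_normC_ge0.
- exact: measurable_int (integrable_normC cfg).
- apply: emeasurable_funD.
    exact: measurable_int (integrable_normC cf).
  exact: measurable_int (integrable_normC cg).
- move=> x _; rewrite -EFinD lee_fin /valL_/=.
  by case: ('oinv_set_val x) => /= [a|]; [exact: le_normcD|rewrite addr0].
Qed.

Lemma L1norm_eq0 f : continuous f -> L1norm f = 0%E -> f = fun=> 0.
Proof.
move=> cf f0; apply/funext => t; apply: ComplexField.Normc.eq0_normc.
apply/eqP; rewrite eq_le normC_ge0 andbT leNgt; apply/negP => ft.
set c := normC (f t) in ft.
have : \forall s \near t, c / 2 < normC (f s).
  have /cvgrPdist_lt/(_ (c / 2)) := continuous_normC cf (x := t).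
  rewrite divr_gt0// => /(_ isT); apply: filterS => s /=.
  move=> /(le_lt_trans (ler_norm _)); rewrite ltrBlDr -ltrBlDl.
  by rewrite -/c {1}(splitr c) addrK.
move=> /unit_interval_nbhsP[e e0 He].
have /andP[t0 t1] : 0 <= val t <= 1.
  by have := set_valP t; rewrite /= in_itv/=.
have e20 : 0 < e / 2 by rewrite divr_gt0.
have e2e : e / 2 < e by rewrite ltr_pdivrMr// ltr_pMr// ltr1n.
pose a := Num.max 0 (val t - e / 2).
pose b := Num.min 1 (val t + e / 2).
have ab : a < b.
  rewrite /a /b gt_max !lt_min ltr01/= ltr_wpDl//=.
  by rewrite ltrBlDr (le_lt_trans t1) ?ltrDl//= ltrBlDr -addrA ltrDl addr_gt0.
have a0 : 0 <= a by rewrite /a le_max lexx.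
have b1 : b <= 1 by rewrite /b ge_min lexx.
have abI : `[a, b]%classic `<=` (`[0, 1]%classic : set R).
  move=> x /=; rewrite !in_itv/= => /andP[ax xb].
  by rewrite (le_trans a0 ax) (le_trans xb b1).
have ec20 : 0 < c / 2 by rewrite divr_gt0.
suff : (0 < L1norm f)%E by rewrite f0 ltxx.
apply: (@lt_le_trans _ _ (\int[mu]_(x in `[a, b]) (c / 2)%:E)%E).
  rewrite integral_cst//= lebesgue_measure_itv/= lte_fin ab.
  by rewrite -EFinD -EFinM lte_fin mulr_gt0// subr_gt0.
have mf := measurable_int _ (integrable_normC cf).
apply: (@le_trans _ _
    (\int[mu]_(x in `[a, b]) ('valL_0 (normC \o f) x)%:E)%E); last first.
  apply: ge0_subset_integral => //= x _.
  by rewrite lee_fin; exact: valL_normC_ge0.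
apply: ge0_le_integral => //=.
- by move=> x _; rewrite lee_fin ltW.
- exact: measurable_funS mf.
move=> x xab; have xI := abI _ xab.
have xA : x \in (`[0, 1]%classic : set R) by rewrite inE.
have E : 'valL_0 (normC \o f) x = normC (f (SigSub xA)).
  by have := congr1 (fun u => u (SigSub xA)) (@valLK _ _ 0 _ (normC \o f)).
suff : c / 2 <= 'valL_0 (normC \o f) x by rewrite lee_fin.
rewrite E ltW// He//=; apply: le_lt_trans e2e.
move: xab; rewrite /= in_itv/= /a /b ge_max le_min => /andP[/andP[_ x1] /andP[_ x2]].
by rewrite distrC ler_norml lerBrDr addrC x1 lerBlDl x2.
Qed.

End Y_metric.

Section Y_structure.
Context {R : realType} {n : nat}.
Implicit Types f g h : Y R n.

HB.instance Definition _ := gen_eqMixin (Y R n).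
HB.instance Definition _ := gen_choiceMixin (Y R n).

Lemma Y_inj f g : Yfun f = Yfun g -> f = g.
Proof.
case: f g => [f f1 f2 f3] [g g1 g2 g3] /= fg; subst g.
by congr MkY; exact: Prop_irrelevance.
Qed.

Definition L1dist f g : R := fine (L1norm (f \- g)).

Let cY f : continuous f.
Proof. exact/smooth01_continuous/Y_smooth. Qed.

Let cYB f g : continuous (f \- g).
Proof. by move=> t; exact: (cvgB (@cY f t) (@cY g t)). Qed.

Lemma L1distxx f : L1dist f f = 0.
Proof.
rewrite /L1dist /L1norm integral0_eq// => x _; rewrite /valL_/=.
case: ('oinv_set_val x) => //= a; rewrite subrr.
by rewrite [normC 0]ComplexField.Normc.normc0.
Qed.

Lemma L1dist_positivity f g : L1dist f g = 0 -> f = g.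
Proof.
move=> fg0; apply/Y_inj/funext => t; apply/eqP; rewrite -subr_eq0; apply/eqP.
suff /(congr1 (fun u => u t)) : f \- g = fun=> 0 by [].
apply: L1norm_eq0; first exact: cYB.
by rewrite -(fineK (L1norm_fin_num (@cYB f g))) [fine _]fg0.
Qed.

Lemma L1dist_sym f g : L1dist f g = L1dist g f.
Proof.
rewrite /L1dist -L1normN; congr (fine (L1norm _)).
by apply/funext => t /=; rewrite opprB.
Qed.

Lemma L1dist_triangle g f h : L1dist f h <= L1dist f g + L1dist g h.
Proof.
have fin (u v : Y R n) : L1norm (Yfun u \- Yfun v) \is a fin_num.
  by apply: L1norm_fin_num; exact: cYB.
rewrite /L1dist -fineD//; apply: fine_le; [exact: fin| |].
  by have := fin f g; have := fin g h; do 2 case: (L1norm _).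
have -> : f \- h = (f \- g) \+ (g \- h).
  by apply/funext => t /=; rewrite addrA subrK.
by apply: L1normD; exact: cYB.
Qed.

HB.instance Definition _ := @isMetric.Build R (Y R n) L1dist
  L1distxx L1dist_positivity L1dist_sym L1dist_triangle.

Let Yopp_circle f t : normC ((\- f) t) = 1.
Proof. by apply: etrans (Y_circle f t); exact: normcN. Qed.

Let Yopp_bound f : (W11norm (\- f)%R <= (1 + pi * n%:R)%:E)%E.
Proof. by rewrite W11normN; [exact: Y_bound|exact: (Y_smooth f 0%N)]. Qed.

Definition Yopp f : Y R n :=
  MkY (Yopp_circle f) (smooth01N (Y_smooth f)) (Yopp_bound f).

Lemma YoppK : involutive Yopp.
Proof. by move=> f; apply/Y_inj/funext => t /=; rewrite opprK. Qed.

Lemma L1dist_opp f g : L1dist (Yopp f) (Yopp g) = L1dist f g.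
Proof.
rewrite /L1dist -L1normN; congr (fine (L1norm _)).
by apply/funext => t /=; rewrite opprB opprK addrC.
Qed.

Lemma Yopp_continuous : continuous Yopp.
Proof.
move=> f A /nbhs_ballP[e /= e0 eA]; apply/nbhs_ballP; exists e => // g fg.
apply: eA; rewrite /ball/= in fg *.
by rewrite L1dist_opp.
Qed.

End Y_structure.

Arguments Yopp : clear implicits.

(* Main.v *)
(* Upper bound.  If f has modulus 1 and the integral of f over an interval
   vanishes, then f turns by more than pi there: otherwise its values lie in the
   half circle centred at the midpoint of the arc.  So on Y_n the n complex
   integrals of f over [j/n, (j+1)/n] never vanish simultaneously, and they form
   an odd map Y_n -> R^(2n) \ 0; Borsuk-Ulam then excludes spheres of dimension
   at least 2n.

   Borsuk-Ulam.  Let h_i be the i-dimensional hemisphere chains (mod 2) of the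
   octahedron, so that the boundary of h_(i+1) is h_i + (-h_i); this survives
   barycentric subdivision.  If s_1, ..., s_m are odd functions to {+,-}, then the
   cup product of the cocycles [s_j changes sign] takes the value 1 on h_m.  Hence
   some arbitrarily small simplex sees a sign change of every coordinate of the
   map.

   Lower bound.  Schur's algorithm identifies the sphere S^(2k+1) of C^(k+1) with
   the finite Blaschke products of degree at most k, compatibly with
   multiplication by scalars.  Restricted to the unit circle, parametrized by
   [0, 1], a Blaschke product of degree at most k has total variation at most
   2 pi k, and although its degree drops as Schur parameters reach the unit
   circle, it varies continuously in L^1.  Take k = n/2, rounded down. *)

Require Import Defs.
From mathcomp Require Import all_boot all_order all_algebra.
From mathcomp Require Import all_classical all_reals all_analysis.
From mathcomp Require Import complex ring lra.
Import numFieldNormedType.Exports.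

Set Implicit Arguments.
Unset Strict Implicit.
Unset Printing Implicit Defensive.
Import Order.TTheory GRing.Theory Num.Theory.

Local Open Scope classical_set_scope.
Local Open Scope ring_scope.

(** * Chains modulo 2 *)

(** The delicate point is L^1 continuity where a Schur parameter reaches the unit circle and the
    Blaschke product degenerates to a constant. What controls it is an identity on the circle: the
    squared distance from the value of a disc automorphism to its parameter z/N is a constant, small
    near the degeneration, times the factor by which the automorphism multiplies angular speed.
    Speeds are nonnegative and the total turning is at most 2 pi times the degree, so the mean
    square distance tends to 0.

    The parameters are rescaled as z/N, where N is the l2 norm of z together with its tail. Their
    modulus is then 1 exactly when the tail vanishes, and changing the sign of all coordinates
    changes the sign of the product.

    For the upper bound, the strict inequality in the turning of each piece is essential, because
    the length bound pi n is not strict.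

    In Borsuk-Ulam, signs are chosen at the zeros as well, so neither a perturbation nor a homology
    theory is required: Stokes' formula for explicit chains suffices. *)

Section mod2_chains.
Variable T : eqType.
Implicit Types (s : seq T) (c d : seq (seq T)) (F : seq T -> bool).

(* Chains are lists of simplices, identified when every cochain with values in
   Z/2 takes the same value on them. *)
Definition ev F c : bool := \big[addb/false]_(s <- c) F s.

Definition eqc c d := forall F, ev F c = ev F d.

Fixpoint faces s : seq (seq T) :=
  if s is x :: s' then s' :: map (cons x) (faces s') else [::].

Definition bd c := flatten (map faces c).

Lemma ev_cat F c d : ev F (c ++ d) = ev F c (+) ev F d.
Proof. exact: big_cat. Qed.

Lemma ev_cons F s c : ev F (s :: c) = F s (+) ev F c.
Proof. exact: big_cons. Qed.

Lemma ev_nil F : ev F [::] = false.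
Proof. exact: big_nil. Qed.

Lemma ev_map F (g : seq T -> seq T) c : ev F (map g c) = ev (F \o g) c.
Proof. exact: big_map. Qed.

Lemma ev_flatten F (g : seq T -> seq (seq T)) c :
  ev F (flatten (map g c)) = ev (fun s => ev F (g s)) c.
Proof. by rewrite /ev big_flatten big_map. Qed.

Lemma evD F G c : ev (fun s => F s (+) G s) c = ev F c (+) ev G c.
Proof. exact: big_split. Qed.

Lemma ev_andl (b : bool) F c : ev (fun s => b && F s) c = b && ev F c.
Proof. by case: b => //; rewrite /ev big1. Qed.

Lemma eq_ev_all (p : pred (seq T)) F G c :
  all p c -> (forall s, p s -> F s = G s) -> ev F c = ev G c.
Proof.
move=> + FG; elim: c => [|s c IH]/=; first by rewrite !ev_nil.
by move=> /andP[/FG sp /IH cp]; rewrite !ev_cons sp cp.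
Qed.

Lemma eqc_flatten (g : seq T -> seq (seq T)) c d :
  eqc c d -> eqc (flatten (map g c)) (flatten (map g d)).
Proof. by move=> cd F; rewrite !ev_flatten cd. Qed.

Lemma bd_cone x c : eqc (bd (map (cons x) c)) (c ++ map (cons x) (bd c)).
Proof.
move=> F; rewrite ev_cat ev_map !ev_flatten ev_map -evD.
apply: eq_bigr => s _ /=; by rewrite ev_cons ev_map.
Qed.

Lemma bd_bd c : eqc (bd (bd c)) [::].
Proof.
move=> F; rewrite ev_flatten ev_flatten ev_nil /ev big1// => s _.
rewrite -/(ev _ _) -ev_flatten -/(bd _).
elim: s F => [|x s IH] F /=; first by rewrite ev_nil.
rewrite /bd/= ev_cat -/(bd _) bd_cone ev_cat addbA addbb/=.
by rewrite ev_map; exact: IH.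
Qed.

Lemma size_faces s : all (fun t => size t == (size s).-1) (faces s).
Proof.
elim: s => //= x s IH; rewrite eqxx/= all_map.
by case: s IH => // y s; apply: sub_all => t /= /eqP ->.
Qed.

(** Barycentric subdivision as the cone from the centre [b s] over the subdivided boundary. The
    recursion is on [n], meant to be [size s]; the centre map [b] stays abstract because only its
    compatibility with the antipode matters for the chain identities. *)
Fixpoint subdiv (b : seq T -> T) n s : seq (seq T) :=
  if n is n'.+1 then map (cons (b s)) (flatten (map (subdiv b n') (faces s)))
  else [:: [::]].

Definition Subdiv b n c := flatten (map (subdiv b n) c).

Definition dimc n c := all (fun s => size s == n) c.

Lemma dimc_flatten n m (g : seq T -> seq (seq T)) c : dimc n c ->
  (forall s, size s = n -> dimc m (g s)) -> dimc m (flatten (map g c)).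
Proof.
move=> + H; elim: c => //= s c IH /andP[/eqP/H sm /IH cm].
by rewrite /dimc all_cat; apply/andP; split.
Qed.

Lemma dimc_cone n x c : dimc n.+1 (map (cons x) c) = dimc n c.
Proof. by rewrite /dimc all_map; apply: eq_all => s. Qed.

Lemma dimc_subdiv b n s : size s = n -> dimc n (subdiv b n s).
Proof.
elim: n s => //= n IH s sn; rewrite dimc_cone.
by apply: dimc_flatten IH; have := size_faces s; rewrite sn.
Qed.

Lemma dimc_Subdiv b n c : dimc n c -> dimc n (Subdiv b n c).
Proof. by move=> /dimc_flatten; apply => s; exact: dimc_subdiv. Qed.

Lemma bd_flatten F (g : seq T -> seq (seq T)) c :
  ev F (bd (flatten (map g c))) = ev (fun s => ev F (bd (g s))) c.
Proof. by rewrite !ev_flatten; apply: eq_bigr => s _; rewrite ev_flatten. Qed.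

(** The boundary of the cone is its base plus the cone over the boundary of the base. By induction
    the latter boundary is the subdivision of the boundary of a boundary, hence zero. *)
Lemma bd_subdiv b n s : size s = n.+1 ->
  eqc (bd (subdiv b n.+1 s)) (Subdiv b n (faces s)).
Proof.
elim: n s => [|n IH] s sn F.
  rewrite [subdiv _ _ _]/= bd_cone ev_cat.
  rewrite ev_map bd_flatten (_ : ev _ (faces s) = false) ?addbF//.
  by rewrite /ev big1// => t _; exact: ev_nil.
rewrite [subdiv _ _ _]/= -/(subdiv b n.+1) bd_cone ev_cat.
rewrite ev_map bd_flatten -[RHS]addbF; congr (_ (+) _).
have fn : dimc n.+1 (faces s) by have := size_faces s; rewrite sn.
rewrite (eq_ev_all fn (G := fun t => ev (F \o cons (b s)) (Subdiv b n (faces t)))); last first.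
  by move=> t /eqP tn; rewrite IH.
(* The subdivision and the coning are absorbed into the cochain, which [eqc] leaves arbitrary, so
   that [bd_bd] applies to the unsubdivided simplex. *)
have := bd_bd [:: s] (fun u => ev (F \o cons (b s)) (subdiv b n u)).
rewrite [bd [:: s]]/bd/= cats0 ev_nil ev_flatten => H; rewrite -[RHS]H.
by apply: eq_bigr => t _; rewrite ev_flatten.
Qed.

Lemma bd_Subdiv b n c : dimc n.+1 c ->
  eqc (bd (Subdiv b n.+1 c)) (Subdiv b n (bd c)).
Proof.
move=> cn F; rewrite bd_flatten /Subdiv ev_flatten/bd ev_flatten.
by apply: (eq_ev_all cn) => s /eqP sn; rewrite bd_subdiv// ev_flatten.
Qed.

Lemma dimc_iter_Subdiv b n N c : dimc n c -> dimc n (iter N (Subdiv b n) c).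
Proof. by move=> cn; elim: N => //= N IH; exact: dimc_Subdiv. Qed.

Lemma bd_iter_Subdiv b n N c : dimc n.+1 c ->
  eqc (bd (iter N (Subdiv b n.+1) c)) (iter N (Subdiv b n) (bd c)).
Proof.
move=> cn; elim: N => //= N IH F; rewrite bd_Subdiv//; last exact: dimc_iter_Subdiv.
by apply: eqc_flatten => G; exact: IH.
Qed.

Lemma eqc_iter_Subdiv b n N c d : eqc c d ->
  eqc (iter N (Subdiv b n) c) (iter N (Subdiv b n) d).
Proof. by move=> cd; elim: N => //= N IH; exact: eqc_flatten. Qed.

Lemma faces_map (f : T -> T) s : faces (map f s) = map (map f) (faces s).
Proof.
elim: s => //= x s ->; congr cons; by rewrite -!map_comp.
Qed.

Lemma subdiv_map b (f : T -> T) n s : (forall t, b (map f t) = f (b t)) ->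
  subdiv b n (map f s) = map (map f) (subdiv b n s).
Proof.
move=> bf; elim: n s => //= n IH s; rewrite bf faces_map.
have -> : flatten (map (subdiv b n) (map (map f) (faces s))) =
    map (map f) (flatten (map (subdiv b n) (faces s))).
  by elim: (faces s) => //= t c ->; rewrite IH map_cat.
by rewrite -!map_comp.
Qed.

Lemma Subdiv_map b (f : T -> T) n c : (forall t, b (map f t) = f (b t)) ->
  Subdiv b n (map (map f) c) = map (map f) (Subdiv b n c).
Proof.
move=> bf; rewrite /Subdiv; elim: c => //= s c ->.
by rewrite map_cat subdiv_map.
Qed.

Lemma iter_Subdiv_map b (f : T -> T) n N c : (forall t, b (map f t) = f (b t)) ->
  iter N (Subdiv b n) (map (map f) c) = map (map f) (iter N (Subdiv b n) c).
Proof. by move=> bf; elim: N => //= N ->; exact: Subdiv_map. Qed.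

Lemma iter_Subdiv_cat b n N c d : iter N (Subdiv b n) (c ++ d) =
  iter N (Subdiv b n) c ++ iter N (Subdiv b n) d.
Proof. by elim: N => //= N ->; rewrite /Subdiv map_cat flatten_cat. Qed.

Section hemispheres.
Variables (nu : T -> T) (e : nat -> T).
Hypothesis nuK : involutive nu.

(* [csphere i] has dimension [i - 1]: [csphere 0] is the empty simplex of the
   augmented complex. *)
Fixpoint csphere i : seq (seq T) :=
  if i is i'.+1 then
    let h := map (cons (e i')) (csphere i') in h ++ map (map nu) h
  else [:: [::]].

Definition hemisphere i := map (cons (e i)) (csphere i).

Lemma dimc_csphere i : dimc i (csphere i).
Proof.
elim: i => //= i IH; rewrite /dimc all_cat -/(dimc _ _) dimc_cone IH/=.
by rewrite all_map -/(dimc _ _) (eq_all (a2 := fun s => size s == i.+1))//;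
  [rewrite -/(dimc _ _) dimc_cone|move=> s /=; rewrite size_map].
Qed.

Lemma dimc_hemisphere i : dimc i.+1 (hemisphere i).
Proof. by rewrite dimc_cone dimc_csphere. Qed.

Lemma csphere_nu i : eqc (map (map nu) (csphere i)) (csphere i).
Proof.
case: i => //= i F; rewrite map_cat !ev_cat addbC; congr (_ (+) _).
rewrite -map_comp (eq_map (g := id)) ?map_id// => s /=.
by rewrite -map_comp (eq_map (g := id)) ?map_id// => x /=.
Qed.

Lemma bd_map (f : T -> T) c : bd (map (map f) c) = map (map f) (bd c).
Proof.
by rewrite /bd; elim: c => //= s c ->; rewrite map_cat faces_map.
Qed.

(** Both halves have boundary equal to the sphere one dimension lower, which is antipodally
    invariant by [csphere_nu]; modulo 2 the two contributions cancel. *)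
Lemma bd_csphere i : eqc (bd (csphere i)) [::].
Proof.
elim: i => //= i IH F; rewrite /bd map_cat flatten_cat ev_cat -!/(bd _).
rewrite bd_map ev_map !bd_cone !ev_cat !ev_map (IH (_ \o _)).
rewrite (IH (_ \o _)) !ev_nil !addbF -ev_map csphere_nu.
by rewrite addbb.
Qed.

Lemma bd_hemisphere i : eqc (bd (hemisphere i)) (csphere i).
Proof.
move=> F; rewrite bd_cone ev_cat ev_map bd_csphere ev_nil.
by rewrite addbF.
Qed.

Variable b : seq T -> T.
Hypothesis b_nu : forall t, b (map nu t) = nu (b t).
Variable N : nat.

Definition sub_hemisphere i := iter N (Subdiv b i.+1) (hemisphere i).

Lemma bd_sub_hemisphere i : eqc (bd (sub_hemisphere i.+1))
  (sub_hemisphere i ++ map (map nu) (sub_hemisphere i)).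
Proof.
move=> F; rewrite bd_iter_Subdiv ?dimc_hemisphere//.
rewrite (eqc_iter_Subdiv _ _ _ (bd_hemisphere _)) /=.
by rewrite iter_Subdiv_cat iter_Subdiv_map.
Qed.

Lemma bd_sub_hemisphere0 : eqc (bd (sub_hemisphere 0)) [:: [::]].
Proof.
move=> F; rewrite bd_iter_Subdiv ?dimc_hemisphere//.
rewrite (eqc_iter_Subdiv _ _ _ (bd_hemisphere _)) /=.
suff -> : iter N (Subdiv b 0) [:: [::]] = [:: [::]] by [].
by elim: N => //= M ->.
Qed.

(* Cup product of the coboundaries of the 0-cochains [ss].  In [cupr ss g] the
   extra last factor [g] is not differentiated, whence [ev_faces_cupr]. *)
Fixpoint cup (ss : seq (T -> bool)) s : bool :=
  match ss, s with
  | [::], _ => true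
  | f :: ss', v0 :: ((v1 :: _) as s') => (f v0 (+) f v1) && cup ss' s'
  | _, _ => false
  end.

Fixpoint cupr (ss : seq (T -> bool)) (g : T -> bool) s : bool :=
  match ss, s with
  | [::], v0 :: _ => g v0
  | f :: ss', v0 :: ((v1 :: _) as s') => (f v0 (+) f v1) && cupr ss' g s'
  | _, _ => false
  end.

(** Leibniz rule: the factors coming from [ss] are cocycles, so only [g] gets differentiated. *)
Lemma ev_faces_cupr ss g s : size s = (size ss).+2 ->
  ev (cupr ss g) (faces s) = cup (rcons ss g) s.
Proof.
elim: ss s => [|f ss IH] [//|v0 [//|v1 s]] /=.
  by case: s => //= _; rewrite !ev_cons ev_nil /= addbF andbT addbC.
case: s => [//|v2 s] [sn].
have /= := IH [:: v1, v2 & s] _; rewrite sn => /(_ erefl) <-.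
rewrite !ev_cons !ev_map/=.
rewrite [X in _ (+) (_ (+) (_ (+) X))]ev_andl.
by case: (f v0); case: (f v1); case: (f v2); case: (cupr ss g _); rewrite //= ?addbF ?addbb.
Qed.

(** Sign changes of odd functions are the same along an edge and along its antipode, while the last
    factor [g] is negated; the two values of [g] sum to 1. *)
Lemma cupr_nu ss g s : size s = (size ss).+1 ->
  {in s, forall v, all (fun f : T -> bool => f (nu v) == ~~ f v) (g :: ss)} ->
  cupr ss g s (+) cupr ss g (map nu s) = cup ss s.
Proof.
elim: ss s => [|f ss IH] [//|v0 s] /=.
  move=> _ /(_ v0); rewrite inE eqxx => /(_ isT)/andP[/eqP -> _].
  by rewrite addbN addbb.
case: s => // v1 s sn H.
rewrite -[map nu (v1 :: s)]/(nu v1 :: map nu s)/=.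
have /and3P[_ /eqP f0 _] := H v0 (mem_head _ _).
have /and3P[_ /eqP f1 _] : all (fun f : T -> bool => f (nu v1) == ~~ f v1) [:: g, f & ss].
  by apply: H; rewrite !inE eqxx orbT.
rewrite f0 f1 -(IH (v1 :: s)); last 2 first.
- exact: succn_inj sn.
- move=> v vs; suff /and3P[P1 _ P2] : all (fun f : T -> bool => f (nu v) == ~~ f v) [:: g, f & ss].
    by apply/andP; split.
  by apply: H; rewrite inE vs orbT.
by rewrite /=; case: (f v0); case: (f v1).
Qed.

Lemma cup_sign_change ss s i : size s = (size ss).+1 -> cup ss s -> (i < size ss)%N ->
  forall v, nth xpredT ss i (nth v s i) (+) nth xpredT ss i (nth v s i.+1).
Proof.
elim: ss s i => [//|f ss IH] [//|v0 [//|v1 s]] [|i] /= [sn] /andP[H0 H1] // ii v.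
by have := IH (v1 :: s) i; apply => //; rewrite /= sn.
Qed.

(** By Stokes the last coboundary becomes an evaluation on a lower hemisphere plus its antipode, and
    [cupr_nu] collapses the two halves to a cup product with one factor fewer. Hence the induction
    removes factors from the end. Oddness is required at the vertices of the chains only, since
    [sign_ofN] provides it only on the octahedron. *)
Lemma ev_cup_sub_hemisphere ss :
  (forall i s v, (i <= size ss)%N -> s \in sub_hemisphere i -> v \in s ->
    all (fun f : T -> bool => f (nu v) == ~~ f v) ss) ->
  ev (cup ss) (sub_hemisphere (size ss)).
Proof.
have dim_sub i : dimc i.+1 (sub_hemisphere i).
  exact/dimc_iter_Subdiv/dimc_hemisphere.
elim/last_ind: ss => [|ss g IH] Hodd.
  (* Without factors the claim is that the number of points is odd; the augmented boundary counts
     one empty simplex for each point. *)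
  have := bd_sub_hemisphere0 xpredT; rewrite ev_cons ev_nil /= => H.
  rewrite /is_true -[RHS]H ev_flatten; apply: (eq_ev_all (dim_sub 0)) => -[|v [|]]//= _.
  by rewrite ev_cons ev_nil.
rewrite size_rcons; transitivity (ev (cupr ss g) (bd (sub_hemisphere (size ss).+1))).
  rewrite ev_flatten; apply: (eq_ev_all (dim_sub _)) => s /eqP sn.
  by rewrite ev_faces_cupr.
rewrite bd_sub_hemisphere ev_cat ev_map -evD.
rewrite -[RHS]IH => [|i s v iss si vs]; last first.
  by have := Hodd i s v; rewrite all_rcons size_rcons (leqW iss) => /(_ _ _ _)/andP[].
apply: eq_big_seq => s sc /=; apply: cupr_nu.
  by have /allP/(_ _ sc)/eqP := dim_sub (size ss).
by move=> v vs; have := Hodd (size ss) s v; rewrite all_rcons size_rcons leqnSn; apply.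
Qed.

End hemispheres.
End mod2_chains.

(** * Barycentric subdivision of the octahedron *)

Section barycentric_subdivision.
Context {R : realType} {k : nat}.
Local Notation V := 'rV[R]_k.+1.
Implicit Types (s t : seq V) (v w : V).

Definition barycenter s : V := (size s)%:R^-1 *: \sum_(v <- s) v.

Lemma barycenterN s : barycenter (map -%R s) = - barycenter s.
Proof. by rewrite /barycenter size_map big_map sumrN scalerN. Qed.

Lemma barycenterB s v : s != [::] ->
  barycenter s - v = (size s)%:R^-1 *: \sum_(w <- s) (w - v).
Proof.
move=> s0; rewrite sumrB scalerBr; congr (_ - _).
rewrite big_const_seq count_predT iter_addr_0.
rewrite -[v *+ _]scaler_nat scalerA mulVf ?scale1r// pnatr_eq0.
by case: s s0.
Qed.

Lemma normr_sum_seq (u : seq V) r : (forall w, w \in u -> `|w| <= r) ->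
  `|\sum_(w <- u) w| <= (size u)%:R * r.
Proof.
elim: u => [|w u IH] H; first by rewrite big_nil normr0 mul0r.
rewrite big_cons /= -natr1 mulrDl mul1r addrC.
apply: le_trans (ler_normD _ _) _; apply: lerD; last by apply: H; rewrite mem_head.
by apply: IH => x xu; apply: H; rewrite inE xu orbT.
Qed.

Lemma barycenter_ball s v r : s != [::] -> (forall w, w \in s -> `|w - v| <= r) ->
  `|barycenter s - v| <= r.
Proof.
move=> s0 H; rewrite barycenterB// normrZ.
have n0 : 0 < (size s)%:R :> R by rewrite ltr0n; case: s s0 {H}.
rewrite normfV gtr0_norm// mulrC ler_pdivrMr// mulrC.
rewrite -(big_map (fun w => w - v) xpredT id) -[size s](size_map (fun w => w - v)).
by apply: normr_sum_seq => _ /mapP[w ws ->]; exact: H.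
Qed.

(** In the average of the differences [w - v] the term [w = v] vanishes, so one of the [size s]
    summands is saved. This is the source of the contraction factor. *)
Lemma barycenter_vertex s v d : v \in s -> {in s &, forall w w', `|w - w'| <= d} ->
  `|barycenter s - v| <= (1 - (size s)%:R^-1) * d.
Proof.
move=> vs H; have s0 : s != [::] by case: s vs {H}.
have n0 : 0 < (size s)%:R :> R by rewrite ltr0n; case: s s0 {H vs}.
rewrite barycenterB// normrZ normfV gtr0_norm//.
have -> : 1 - (size s)%:R^-1 = (size s)%:R^-1 * (size s).-1%:R :> R.
  rewrite -subn1 natrB; last by case: s s0 {H vs n0}.
  by rewrite mulrBr mulVf ?gt_eqF// mulr1.
rewrite -mulrA ler_pM2l ?invr_gt0//.
rewrite (perm_big _ (perm_to_rem vs)) big_cons /= subrr add0r.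
rewrite -(size_rem vs) -(big_map (fun w => w - v) xpredT id) -[size _](size_map (fun w => w - v)).
by apply: normr_sum_seq => _ /mapP[w ws ->]; apply: H => //; exact: mem_rem ws.
Qed.

Lemma mem_faces s t : t \in faces s -> {subset t <= s}.
Proof.
elim: s t => //= x s IH t; rewrite inE => /predU1P[-> y ys|].
  by rewrite inE ys orbT.
move=> /mapP[u us ->] y; rewrite !inE => /predU1P[->|/(IH _ us) ->].
  by rewrite eqxx.
by rewrite orbT.
Qed.

Lemma size_mem_faces n s t : size s = n.+1 -> t \in faces s -> size t = n.
Proof. by move=> sn /(allP (size_faces s)) /eqP ->; rewrite sn. Qed.

Lemma mem_subdivS n s t : t \in subdiv barycenter n.+1 s ->
  exists u t', [/\ u \in faces s, t' \in subdiv barycenter n u &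
    t = barycenter s :: t'].
Proof.
by move=> /mapP[t' /flatten_mapP[u us t'u] ->]; exists u, t'.
Qed.

(** Applied to balls, for the diameter estimate, and to the facets of the octahedron. *)
Lemma subdiv_stable (Q : V -> Prop) n s t w :
  (forall s, s != [::] -> (forall v, v \in s -> Q v) -> Q (barycenter s)) ->
  size s = n -> (forall v, v \in s -> Q v) ->
  t \in subdiv barycenter n s -> w \in t -> Q w.
Proof.
move=> Qb; elim: n s t w => [|n IH] s t w sn sQ.
  by rewrite inE => /eqP ->.
move=> /mem_subdivS[u [t' [us t'u ->]]]; rewrite inE => /predU1P[->|wt'].
  by apply: Qb => //; rewrite -size_eq0 sn.
apply: IH t'u wt'; first exact: size_mem_faces us.
by move=> v vu; apply: sQ; exact: mem_faces vu.
Qed.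

Definition shrink : R := 1 - k.+1%:R^-1.

Lemma shrink_ge0 : 0 <= shrink.
Proof. by rewrite subr_ge0 invf_le1// ler1n. Qed.

Lemma shrink_lt1 : shrink < 1.
Proof. by rewrite gtrBl invr_gt0. Qed.

(** A simplex of the subdivision is the barycenter of [s] followed by a simplex of a subdivided
    face. Distances to the barycenter are bounded on the vertices of [s], hence on the ball they
    span; distances inside the face are bounded by induction. *)
Lemma subdiv_diam n s t d : (n <= k.+1)%N -> size s = n -> 0 <= d ->
  {in s &, forall w w', `|w - w'| <= d} ->
  t \in subdiv barycenter n s -> {in t &, forall w w', `|w - w'| <= shrink * d}.
Proof.
elim: n s t => [|n IH] s t nk sn d0 sd; first by rewrite inE => /eqP -> ?.
move=> /mem_subdivS[u [t' [us t'u ->]]].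
have s0 : s != [::] by rewrite -size_eq0 sn.
have bs v : v \in s -> `|v - barycenter s| <= shrink * d.
  move=> vs; rewrite distrC; apply: le_trans (barycenter_vertex vs sd) _.
  rewrite ler_wpM2r// lerB// sn lef_pV2 ?posrE ?ltr0n// ler_nat.
  exact: nk.
have un := size_mem_faces sn us.
have bt v : v \in t' -> `|v - barycenter s| <= shrink * d.
  move=> vt'; apply: (@subdiv_stable (fun v => `|v - barycenter s| <= shrink * d) n u t') => //.
    by move=> s' s'0; exact: barycenter_ball.
  by move=> w wu; apply: bs; exact: mem_faces wu.
move=> v w; rewrite !inE => /predU1P[->|vt] /predU1P[->|wt].
- by rewrite subrr normr0 mulr_ge0// shrink_ge0.
- by rewrite distrC; exact: bt.
- exact: bt.
- apply: (IH u t') => //; first exact: ltnW.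
  by move=> x y xu yu; apply: sd; exact: mem_faces us _ _.
Qed.

Lemma iter_Subdiv_diam N n c d : (n <= k.+1)%N -> dimc n c -> 0 <= d ->
  (forall s, s \in c -> {in s &, forall w w', `|w - w'| <= d}) ->
  forall s, s \in iter N (Subdiv barycenter n) c ->
    {in s &, forall w w', `|w - w'| <= shrink ^+ N * d}.
Proof.
move=> nk cn d0 cd; elim: N => [|N IH] s; first by rewrite expr0 mul1r; exact: cd.
move=> /flatten_mapP[t tc st]; rewrite exprS -mulrA.
apply: subdiv_diam st => //; last exact: IH.
- exact: (eqP (allP (dimc_iter_Subdiv _ N cn) _ tc)).
- by rewrite mulr_ge0// exprn_ge0// shrink_ge0.
Qed.

(** For fixed signs these conditions are affine, hence stable under barycenters; the octahedron
    itself is not convex. *)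
Definition in_facet (eps : 'I_k.+1 -> R) v :=
  (forall i, 0 <= eps i * v 0 i) /\ \sum_i eps i * v 0 i = 1.

Lemma barycenter_in_facet eps s : s != [::] ->
  (forall v, v \in s -> in_facet eps v) -> in_facet eps (barycenter s).
Proof.
move=> s0 H; have n0 : 0 < (size s)%:R :> R by rewrite ltr0n; case: s s0 {H}.
have E i : eps i * barycenter s 0 i = (size s)%:R^-1 * \sum_(v <- s) eps i * v 0 i.
  by rewrite mxE mulrCA summxE mulr_sumr.
split=> [i|].
  rewrite E mulr_ge0 ?invr_ge0 ?ler0n// big_seq sumr_ge0// => v vs.
  by have [] := H v vs.
under eq_bigr do rewrite E.
rewrite -mulr_sumr exchange_big/= big_seq.
under eq_bigr => v vs do rewrite (H v vs).2.
by rewrite -big_seq big_const_seq count_predT iter_addr_0 mulVf// gt_eqF.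
Qed.

Definition in_some_facet s := exists eps : 'I_k.+1 -> R,
  (forall i, `|eps i| = 1) /\ forall v, v \in s -> in_facet eps v.

Lemma iter_Subdiv_facet N n c : dimc n c ->
  (forall s, s \in c -> in_some_facet s) ->
  forall s, s \in iter N (Subdiv barycenter n) c -> in_some_facet s.
Proof.
move=> cn cP; elim: N => [|N IH] s; first exact: cP.
move=> /flatten_mapP[t tc st]; have [eps [e1 et]] := IH _ tc.
exists eps; split=> // v vs.
apply: (subdiv_stable (@barycenter_in_facet eps) _ et st vs).
exact: (eqP (allP (dimc_iter_Subdiv _ N cn) _ tc)).
Qed.

Definition basis i : V := delta_mx 0 (inord i).

Lemma csphere_facet i s : (i <= k.+1)%N -> s \in csphere -%R basis i ->
  exists eps : 'I_k.+1 -> R, (forall j, `|eps j| = 1) /\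
    forall v, v \in s -> in_facet eps v /\ forall j : 'I_k.+1, (i <= j)%N -> v 0 j = 0.
Proof.
elim: i s => [|i IH] s ik.
  rewrite inE => /eqP ->; exists (fun=> 1); split=> // j; exact: normr1.
have main u : u \in map (cons (basis i)) (csphere -%R basis i) ->
    exists eps : 'I_k.+1 -> R, (forall j, `|eps j| = 1) /\
    forall v, v \in u -> in_facet eps v /\ forall j : 'I_k.+1, (i < j)%N -> v 0 j = 0.
  move=> /mapP[t /(IH _ (ltnW ik))[eps [e1 et]] ->].
  (* The new vertex [basis i] forces the sign 1 in coordinate [i]. On the old vertices this
     coordinate is 0, which is why the statement also records vanishing coordinates. *)
  pose eps' j := if j == inord i then 1 else eps j.
  exists eps'; split=> [j|v].
    by rewrite /eps'; case: ifP => // _; exact: normr1.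
  rewrite inE => /predU1P[->|vt].
    split; last first.
      move=> j ij; rewrite mxE eqxx/= -(inj_eq val_inj)/= inordK//.
      by rewrite gtn_eqF.
    split=> [j|].
      by rewrite mxE eqxx/= /eps'; case: ifP; rewrite ?mulr1 ?mulr0.
    rewrite (bigD1 (inord i))//= mxE !eqxx /eps' eqxx mulr1 big1 ?addr0// => j /negPf ji.
    by rewrite mxE ji andbF mulr0.
  have [[v0 v1] vi] := et v vt.
  have E j : eps' j * v 0 j = eps j * v 0 j.
    rewrite /eps'; case: eqP => // ->; rewrite [v _ _]vi ?mulr0//.
    by rewrite inordK.
  split; last by move=> j ij; apply: vi; exact: ltnW.
  by split=> [j|]; [rewrite E|under eq_bigr do rewrite E].
rewrite /= mem_cat => /orP[/main//|/mapP[t /main[eps [e1 et]] ->]].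
exists (fun j => - eps j); split=> [j|v /mapP[w wt ->]]; first by rewrite normrN.
have [[w0 w1] wi] := et w wt.
split; last by move=> j ij; rewrite mxE wi// oppr0.
by split=> [j|]; [|under eq_bigr do rewrite mxE mulrNN]; rewrite // mxE mulrNN.
Qed.

Lemma hemisphere_facet i s : (i <= k)%N -> s \in hemisphere -%R basis i ->
  in_some_facet s.
Proof.
move=> ik si; have : s \in csphere -%R basis i.+1.
  by rewrite /= mem_cat -/(hemisphere _ _ _) si.
move=> /(csphere_facet _)[//|eps [e1 H]].
by exists eps; split=> // v /H[].
Qed.

Definition octahedron : set V := [set v | \sum_i `|v 0 i| = 1].

Lemma in_facet_octahedron eps v : (forall i, `|eps i| = 1) -> in_facet eps v ->
  octahedron v.
Proof.
move=> e1 [v0 v1]; rewrite /octahedron/= -[RHS]v1; apply: eq_bigr => i _.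
by rewrite -[RHS]ger0_norm// normrM e1 mul1r.
Qed.

Lemma octahedron_norm v : octahedron v -> `|v| <= 1.
Proof.
move=> v1; rewrite -[1]v1 /Num.norm/= mx_normrE.
apply: bigmax_le; first by apply: sumr_ge0 => i _; exact: normr_ge0.
move=> [i j] _ /=; rewrite ord1 (bigD1 j)//= lerDl; apply: sumr_ge0 => l _; exact: normr_ge0.
Qed.

End barycentric_subdivision.

(** * The Borsuk-Ulam theorem *)

Section borsuk_ulam.
Context {R : realType} {k : nat}.
Local Notation V := 'rV[R]_k.+1.
Implicit Types (v w : V).

Lemma octahedron_compact : compact (@octahedron R k).
Proof.
apply: bounded_closed_compact.
  exists 1; split; first exact: num_real.
  by move=> r r1 v /octahedron_norm /le_trans; apply; exact: ltW.
have cf : continuous (fun v : V => \sum_i `|v 0 i|).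
  apply: continuous_big => [|i _]; first exact: add_continuous.
  move=> v; apply: (@continuous_comp _ _ _ (fun w : V => w 0 i) Num.norm).
    exact: coord_continuous.
  exact: norm_continuous.
by have /continuous_closedP/(_ [set 1] (@closed_eq _ _)) := cf.
Qed.

Definition sqnorm v := \sum_i v 0 i ^+ 2.

Lemma sqnorm_continuous : continuous sqnorm.
Proof.
apply: continuous_big => [|i _ v]; first exact: add_continuous.
apply: (@continuous_comp _ _ _ (fun w : V => w 0 i) (fun r => r ^+ 2)).
  exact: coord_continuous.
exact: exprn_continuous.
Qed.

Lemma octahedron_sqnorm v : octahedron v -> 0 < sqnorm v.
Proof.
move=> v1; rewrite lt_neqAle sumr_ge0 ?andbT; last by move=> i _; exact: sqr_ge0.
apply/eqP => /esym/eqP; rewrite psumr_eq0; last by move=> i _; exact: sqr_ge0.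
move=> /allP v0; move: v1; rewrite /octahedron/= big1 => [/esym/eqP|i _].
  by rewrite oner_eq0.
by have := v0 i (mem_index_enum _); rewrite sqrf_eq0 => /eqP ->; rewrite normr0.
Qed.

Definition normalize v : V := (Num.sqrt (sqnorm v))^-1 *: v.

Lemma normalize_sphere v : octahedron v -> sphere R k (normalize v).
Proof.
move=> /octahedron_sqnorm v0; rewrite /sphere/=.
under eq_bigr do rewrite mxE exprMn.
rewrite -mulr_sumr exprVn sqr_sqrtr ?(ltW v0)// mulVf// gt_eqF//.
Qed.

Lemma basis_octahedron : octahedron (@basis R k 0).
Proof.
rewrite /octahedron/= (bigD1 (inord 0))//= mxE !eqxx normr1 big1 ?addr0// => i /negPf i0.
by rewrite mxE i0 andbF normr0.
Qed.

(** Total on [V] so that chains need not carry proofs of membership; on the octahedron the default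
    is never taken, by [val_to_sphere]. *)
Definition to_sphere v : sphere R k :=
  insubd (SigSub (mem_set (normalize_sphere basis_octahedron))) (normalize v).

Lemma val_to_sphere v : octahedron v -> val (to_sphere v) = normalize v.
Proof.
move=> v1; rewrite /to_sphere val_insubd ifT//.
exact/mem_set/normalize_sphere.
Qed.

Lemma octahedronN v : octahedron v -> octahedron (- v).
Proof.
by rewrite /octahedron/= => v1; rewrite -[RHS]v1; apply: eq_bigr => i _; rewrite mxE normrN.
Qed.

Lemma normalizeN v : normalize (- v) = - normalize v.
Proof.
rewrite /normalize scalerN (_ : sqnorm (- v) = sqnorm v)//.
by apply: eq_bigr => i _; rewrite mxE sqrrN.
Qed.

Lemma to_sphereN v : octahedron v -> to_sphere (- v) = antipode (to_sphere v).
Proof.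
move=> v1; apply: val_inj; rewrite val_to_sphere; last exact: octahedronN.
by rewrite normalizeN -val_to_sphere.
Qed.

Lemma normalize_continuous v : octahedron v -> {for v, continuous normalize}.
Proof.
move=> v1.
have sC : Num.sqrt (sqnorm w) @[w --> v] --> Num.sqrt (sqnorm v).
  apply: (@continuous_comp _ _ _ sqnorm Num.sqrt).
    exact: sqnorm_continuous.
  exact: sqrt_continuous.
have s0 : Num.sqrt (sqnorm v) != 0.
  by rewrite gt_eqF// sqrtr_gt0 octahedron_sqnorm.
have H := cvgZ (cvgV s0 sC) (@cvg_id _ (nbhs v)); exact: H.
Qed.

Lemma nbhs_sphereP (x : sphere R k) (P : set (sphere R k)) : nbhs x P ->
  exists2 e : R, 0 < e & forall y, `|val x - val y| < e -> P y.
Proof.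
move=> /(nbhs_ballP x)[e /= e0 eP]; exists e => // y xy; apply: eP.
by suff : ball (val x) e (val y) by []; rewrite -ball_normE.
Qed.

Lemma to_sphere_continuous (f : sphere R k -> R) v e : continuous f ->
  octahedron v -> 0 < e ->
  \forall w \near v, octahedron w -> `|f (to_sphere v) - f (to_sphere w)| < e.
Proof.
move=> cf v1 e0; have /cvgrPdist_lt/(_ e e0)/nbhs_sphereP[d d0 dP] := cf (to_sphere v).
have /cvgrPdist_lt/(_ d d0) := normalize_continuous v1.
apply: filterS => w vw w1; apply: dP.
by rewrite !val_to_sphere.
Qed.

(* An odd choice of sign at the zeros of [f], to make [sign_of f] odd. *)
Definition lexpos v :=
  if [pick i | v 0 i != 0] is Some i then 0 < v 0 i else false.

Lemma lexposN v : octahedron v -> lexpos (- v) = ~~ lexpos v.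
Proof.
move=> v1; rewrite /lexpos (@eq_pick _ _ (fun i => v 0 i != 0)); last first.
  by move=> i; rewrite mxE oppr_eq0.
case: pickP => [i vi|v0].
  by rewrite mxE oppr_gt0 -leNgt le_eqVlt (negPf vi).
move: v1; rewrite /octahedron/= big1 => [/esym/eqP|i _]; first by rewrite oner_eq0.
by have /negbFE/eqP -> := v0 i; rewrite normr0.
Qed.

Definition sign_of (f : V -> R) v := if f v == 0 then lexpos v else 0 < f v.

Lemma sign_ofN f v : octahedron v -> f (- v) = - f v ->
  sign_of f (- v) = ~~ sign_of f v.
Proof.
move=> v1 fv; rewrite /sign_of fv oppr_eq0; case: ifPn => [_|f0].
  exact: lexposN.
by rewrite oppr_gt0 -leNgt le_eqVlt (negPf f0).
Qed.

Lemma ev_exists (T : eqType) F (c : seq (seq T)) : ev F c -> exists2 s, s \in c & F s.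
Proof.
move=> H; apply/hasP; apply: contraLR H => /hasPn H.
rewrite /ev big_seq big1// => s sc; exact/negbTE/H.
Qed.

Theorem borsuk_ulam m (g : 'I_m -> sphere R k -> R) : (m <= k)%N ->
  (forall j, continuous (g j)) ->
  (forall j x, g j (antipode x) = - g j x) ->
  exists x, forall j, g j x = 0.
Proof.
move=> mk cg gN; apply: contrapT => /forallNP g0.
have {}g0 x : exists j, g j x != 0.
  by have /existsNP[j /eqP] := g0 x; exists j.
pose h j v := g j (to_sphere v).
have hN j v : octahedron v -> h j (- v) = - h j v.
  by move=> v1; rewrite /h to_sphereN.
have /compact_near_coveringP NC := octahedron_compact.
(* A Lebesgue number argument: compactness yields one radius [d] such that around every point of the
   octahedron some coordinate keeps its sign within distance [d]. *)
pose P d v := octahedron v -> exists j, forall w, octahedron w ->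
    `|v - w| < d -> 0 < h j v * h j w.
have : \forall d \near 0^'+, @octahedron R k `<=` P d.
  apply: NC => v v1.
  have [j gj] := g0 (to_sphere v).
  have e0 : 0 < `|h j v| by rewrite normr_gt0.
  have /nbhs_ballP[d /= d0 dP] := to_sphere_continuous (cg j) v1 e0.
  have Pv w : octahedron w -> `|v - w| < d -> 0 < h j v * h j w.
    move=> w1 vw; have := dP w; rewrite -ball_normE/= => /(_ vw w1).
    rewrite -/(h j v) -/(h j w); have [v0|v0|v0] := ltgtP (h j v) 0.
    - rewrite ltr_norml ltr0_norm// => /andP[? ?]; rewrite nmulr_rgt0//; lra.
    - rewrite ltr_norml gtr0_norm// => /andP[? ?]; rewrite pmulr_rgt0//; lra.
    - by rewrite v0 normr0 ltxx in e0.
  (* With half the radius, a point near a point near [v] still lies in the ball where [h j] keeps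
     its sign, so the same [j] serves for all points near [v]. *)
  have d20 : 0 < d / 2 by rewrite divr_gt0.
  exists (ball v (d / 2), [set r | r < d / 2]) => /=.
    split; first exact: nbhsx_ballx.
    exact: nbhs_right_lt.
  case=> w r [/= vw rd] w1; exists j => u u1 wu.
  rewrite -ball_normE/= in vw.
  have hw : 0 < h j v * h j w by apply: Pv => //; apply: lt_trans vw _; lra.
  have hu : 0 < h j v * h j u.
    apply: Pv => //; apply: le_lt_trans (ler_distD w _ _) _; lra.
  have := mulr_gt0 hw hu; rewrite mulrACA -expr2 pmulr_rgt0//.
  by rewrite exprn_even_gt0//=; exact: gj.
move=> dP0; have [d [d0 dP]] : exists d : R, 0 < d /\ @octahedron R k `<=` P d.
  near (0 : R)^'+ => d; exists d; split; near: d; [exact: nbhs_right_gt|exact: dP0].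
(* The factor 2 bounds the diameter of the initial simplices, whose vertices have norm at most 1. *)
have [N dN] : exists N, @shrink R k ^+ N * 2 < d.
  have s1 : `|@shrink R k| < 1 by rewrite ger0_norm ?shrink_lt1// shrink_ge0.
  have /cvgrPdist_lt/(_ (d / 2))[|N _ HN] := cvg_expr s1; first by rewrite divr_gt0.
  exists N; have := HN N (leqnn N); rewrite /= sub0r normrN => /(le_lt_trans (ler_norm _)).
  lra.
pose ss := [seq sign_of (h j) | j <- enum 'I_m].
have sm : size ss = m by rewrite size_map size_enum_ord.
pose H := sub_hemisphere (-%R) (@basis R k) barycenter N.
have facetH i s : (i <= k)%N -> s \in H i -> in_some_facet s.
  move=> ik; apply: iter_Subdiv_facet; first exact: dimc_hemisphere.
  by move=> t; exact: hemisphere_facet.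
have octH i s v : (i <= k)%N -> s \in H i -> v \in s -> octahedron v.
  move=> ik /(facetH _ _ ik)[eps [e1 es]] /es; exact: in_facet_octahedron.
have : ev (cup ss) (H m).
  have := @ev_cup_sub_hemisphere _ -%R (@basis R k) (@opprK V) _ barycenterN N ss.
  rewrite sm; apply => i s v im si vs; have v1 := octH i s v (leq_trans im mk) si vs.
  apply/allP => _ /mapP[j _ ->]; rewrite sign_ofN//; exact: hN.
move=> /ev_exists[s sH cs].
have ss1 : size s = (size ss).+1.
  rewrite sm; apply/eqP; apply: (allP (dimc_iter_Subdiv _ _ _)) sH.
  exact: dimc_hemisphere.
have s_near : {in s &, forall v w, `|v - w| < d}.
  move=> v w vs ws; apply: le_lt_trans dN.
  apply: (iter_Subdiv_diam _ _ _ _ sH vs ws) => //.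
  - exact: dimc_hemisphere.
  - move=> t tm x y xt yt; apply: le_trans (ler_normB _ _) _.
    have [eps [e1 es]] := hemisphere_facet mk tm.
    have nx z : z \in t -> `|z| <= 1.
      by move=> /es/(in_facet_octahedron e1)/octahedron_norm.
    by have := nx _ xt; have := nx _ yt; lra.
have s_oct v : v \in s -> octahedron v by exact: octH sH.
(* The coordinate [j] that keeps its sign near the first vertex must change sign along the [j]-th
   edge of the small simplex, a contradiction. Positivity of the products excludes zeros there, so
   [lexpos] does not interfere. *)
pose v0 := nth 0 s 0.
have v0s : v0 \in s by rewrite mem_nth// ss1.
have [j hj] := dP _ (s_oct _ v0s) (s_oct _ v0s).
have jm : (j < size ss)%N by rewrite sm.
have := cup_sign_change ss1 cs jm 0.
have -> : nth xpredT ss j = sign_of (h j).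
  by rewrite (nth_map j) ?size_enum_ord// nth_ord_enum.
have sj i : (i <= size ss)%N -> 0 < h j v0 * h j (nth 0 s i).
  move=> im; have si : nth 0 s i \in s by rewrite mem_nth// ss1.
  by apply: hj; [exact: s_oct|exact: s_near].
have := sj j.+1 jm; have := sj j (ltnW jm).
rewrite /sign_of; move: (h j v0) (h j s`_j) (h j s`_j.+1) => x y z.
have [x0|x0|x0] := ltgtP x 0; last by rewrite x0 mul0r ltxx.
- rewrite !nmulr_rgt0// => y0 z0.
  by rewrite !lt_eqF// !ltNge !ltW.
- rewrite !pmulr_rgt0// => y0 z0.
  by rewrite !gt_eqF// y0 z0.
Unshelve. all: by end_near. Qed.

End borsuk_ulam.

(** * Paths in the circle with vanishing mean *)

Section real_calculus.
Context {R : realType}.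
Local Notation mu := (@lebesgue_measure R).
Implicit Types (f g F : R -> R) (a b t : R).

Lemma is_derive_epsP f (x l : R) :
  is_derive x 1 f l <-> forall e, 0 < e -> exists2 d, 0 < d &
    forall h, h != 0 -> `|h| < d -> `|(f (x + h) - f x) / h - l| < e.
Proof.
split=> [[df fl] e e0|H].
  have /cvgrPdist_lt/(_ e e0) : h^-1 *: (f (h *: 1 + x) - f x) @[h --> 0^'] --> l.
    by rewrite -fl; exact: df.
  rewrite near_withinE => /nbhs_ballP[d /= d0 dP]; exists d => // h h0 hd.
  have := dP h; rewrite -ball_normE/= sub0r normrN => /(_ hd h0).
  by rewrite distrC /GRing.scale/= mulr1 mulrC (addrC h).
have C : h^-1 *: (f (h *: 1 + x) - f x) @[h --> 0^'] --> l.
  apply/cvgrPdist_lt => e e0; have [d d0 dP] := H e e0.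
  rewrite near_withinE; apply/nbhs_ballP; exists d => //= h.
  rewrite -ball_normE/= sub0r normrN => hd h0; have := dP h h0 hd.
  by rewrite distrC /GRing.scale/= mulr1 mulrC (addrC h).
split; last exact: cvg_lim C.
by apply/cvg_ex; exists l.
Qed.

Lemma is_derive_addf f g (x a b : R) : is_derive x 1 f a -> is_derive x 1 g b ->
  is_derive x 1 (fun t => f t + g t) (a + b).
Proof. exact: is_deriveD. Qed.

Lemma is_derive_subf f g (x a b : R) : is_derive x 1 f a -> is_derive x 1 g b ->
  is_derive x 1 (fun t => f t - g t) (a - b).
Proof. exact: is_deriveB. Qed.

Lemma is_derive_mulf f g (x a b : R) : is_derive x 1 f a -> is_derive x 1 g b ->
  is_derive x 1 (fun t => f t * g t) (a * g x + f x * b).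
Proof.
move=> df dg; apply: (is_derive_eq (is_deriveM df dg)).
by rewrite /GRing.scale/= addrC mulrC.
Qed.

Lemma is_derive_compf f g (x a b : R) : is_derive (g x) 1 f a -> is_derive x 1 g b ->
  is_derive x 1 (fun t => f (g t)) (a * b).
Proof. exact: is_derive1_comp. Qed.

Lemma is_derive_continuous f (x l : R) : is_derive x 1 f l -> {for x, continuous f}.
Proof. by move=> [df _]; exact/differentiable_continuous/derivable1_diffP. Qed.

Lemma within_continuous (A : set R) f : (forall t, A t -> {for t, continuous f}) ->
  {within A, continuous f}.
Proof.
by move=> cf; apply/subspace_continuousP => t /cf; exact: cvg_within_filter.
Qed.

Lemma MVT_on (P : set R) F f a b : (forall t, P t -> is_derive t 1 F (f t)) ->
  a < b -> `[a, b] `<=` P ->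
  exists2 c, c \in `]a, b[ & F b - F a = f c * (b - a).
Proof.
move=> dF ab abP; apply: MVT => //.
  by move=> t tab; apply/dF/abP; exact: subset_itv_oo_cc.
by apply: within_continuous => t /abP/dF; exact: is_derive_continuous.
Qed.

Lemma derive_ge0_le (P : set R) F f a b : (forall t, P t -> is_derive t 1 F (f t)) ->
  a <= b -> `[a, b] `<=` P -> (forall t, t \in `[a, b] -> 0 <= f t) -> F a <= F b.
Proof.
move=> dF; rewrite le_eqVlt => /predU1P[->//|ab] abP f0.
have [c cab E] := MVT_on dF ab abP.
rewrite -subr_ge0 E; apply: mulr_ge0; last by rewrite subr_ge0 ltW.
by apply: f0; exact: subset_itv_oo_cc.
Qed.

Lemma continuous_integrable f a b : continuous f -> mu.-integrable `[a, b] (EFin \o f).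
Proof.
move=> cf; apply: continuous_compact_integrable; first exact: segment_compact.
exact: continuous_subspaceT.
Qed.

(** The interval is larger than [0, 1] so that the primitive has two-sided derivatives at 0 and 1
    too. *)
Lemma exists_primitive f : continuous f ->
  exists F, forall t, t \in `](-1), 2[ -> is_derive t 1 F (f t).
Proof.
move=> cf; exists (fun x => \int[mu]_(t in `[(-1), x]) f t)%R => t.
rewrite in_itv/= => /andP[t1 t2].
have [dF Ff] := continuous_FTC1_closed t2 (continuous_integrable _ _ cf) t1 (cf t).
by split; [exact: dF|rewrite -derive1E].
Qed.

Lemma integral_primitive (P : set R) F f a b : continuous f ->
  (forall t, P t -> is_derive t 1 F (f t)) ->
  a < b -> `[a, b] `<=` P ->
  (\int[mu]_(t in `[a, b]) (f t)%:E = (F b - F a)%:E)%E.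
Proof.
move=> cf dF ab abP; rewrite (@continuous_FTC2 _ f F)//.
- exact: continuous_subspaceT.
- split=> [t tab||].
  + by have [] := dF t (abP _ (subset_itv_oo_cc tab)).
  + apply: cvg_at_right_filter; apply: is_derive_continuous (dF a _).
    by apply: abP; rewrite /= in_itv/= lexx ltW.
  + apply: cvg_at_left_filter; apply: is_derive_continuous (dF b _).
    by apply: abP; rewrite /= in_itv/= lexx ltW.
- move=> t tab; rewrite derive1E.
  by have [_] := dF t (abP _ (subset_itv_oo_cc tab)).
Qed.

Lemma Rintegral_primitive (P : set R) F f a b : continuous f ->
  (forall t, P t -> is_derive t 1 F (f t)) ->
  a < b -> `[a, b] `<=` P -> \int[mu]_(t in `[a, b]) f t = F b - F a.
Proof. by move=> cf dF ab abP; rewrite /Rintegral (integral_primitive cf dF ab abP). Qed.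

End real_calculus.

Section circle_paths.
Context {R : realType}.
Local Notation D := (`](-1 : R), 2[%classic : set R).

(* An arc of length at most pi lies in the closed half circle centred at its
   midpoint. *)
Lemma short_arc_mean_neq0 (Th L PX PY X Y r : R -> R) (A B a b : R) :
  (forall t, D t -> is_derive t 1 Th (r t)) ->
  (forall t, D t -> is_derive t 1 L `|r t|) ->
  (forall t, D t -> is_derive t 1 PX (X t)) ->
  (forall t, D t -> is_derive t 1 PY (Y t)) ->
  A ^+ 2 + B ^+ 2 = 1 -> a < b -> `[a, b] `<=` D ->
  (forall t, t \in `[a, b] -> X t = A * cos (Th t) - B * sin (Th t)) ->
  (forall t, t \in `[a, b] -> Y t = A * sin (Th t) + B * cos (Th t)) ->
  PX b = PX a -> PY b = PY a -> pi < L b - L a.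
Proof.
move=> dTh dL dPX dPY AB ab abD XE YE PX0 PY0; rewrite ltNge; apply/negP => Lpi.
have sub u v : a <= u -> v <= b -> `[u, v] `<=` D.
  move=> au vb; apply: subset_trans abD; apply: subset_itv; rewrite bnd_simp//.
have Lmono u v : a <= u -> u <= v -> v <= b -> L u <= L v.
  by move=> au uv vb; apply: (derive_ge0_le dL) => //; exact: sub.
have ThL u v : a <= u -> u <= v -> v <= b -> `|Th v - Th u| <= L v - L u.
  move=> au uv vb; have uvD := sub u v au vb.
  rewrite ler_norml; apply/andP; split.
    rewrite -subr_ge0 opprK addrACA -opprD subr_ge0 addrC [leRHS]addrC.
    apply: (@derive_ge0_le _ D (Th + L) (fun t => r t + `|r t|) u v _ uv uvD) => [t tD|t _].
      by apply: is_deriveD; [exact: dTh|exact: dL].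
    by have := ler_norm (- r t); rewrite normrN; lra.
  suff : L u - Th u <= L v - Th v by lra.
  apply: (@derive_ge0_le _ D (L - Th) (fun t => `|r t| - r t) u v _ uv uvD) => [t tD|t _].
    by apply: is_deriveB; [exact: dL|exact: dTh].
  by rewrite subr_ge0 ler_norm.
have cL : {within `[a, b], continuous L}.
  by apply: within_continuous => t /abD/dL; exact: is_derive_continuous.
(* [c] is the midpoint by arc length, from the intermediate value theorem. If the arc has length
   zero, [L] is constant and the midpoint of the parameter interval serves; the case is separate
   because [c] has to be an interior point. *)
have [c cab Lc] : exists2 c, c \in `]a, b[ & forall t, t \in `[a, b] -> `|L t - L c| <= pi / 2.
  have Lab := Lmono a b (lexx _) (ltW ab) (lexx _).
  have [Lab'|Lab'] := eqVneq (L a) (L b).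
    exists ((a + b) / 2); first by rewrite in_itv/=; apply/andP; split; lra.
    move=> t; rewrite in_itv/= => /andP[at_ tb].
    have := Lmono a t (lexx _) at_ tb; have := Lmono t b at_ tb (lexx _).
    have := Lmono a ((a + b) / 2) (lexx _); have := Lmono ((a + b) / 2) b.
    move=> /(_ _ _ (lexx _)) H1 /(_ _ _) H2.
    have {}H1 : L ((a + b) / 2) <= L b by apply: H1; lra.
    have {}H2 : L a <= L ((a + b) / 2) by apply: H2; lra.
    move=> H3 H4; have -> : L t - L ((a + b) / 2) = 0 by lra.
    by rewrite normr0 divr_ge0// pi_ge0.
  have [|c cab Lc] := @IVT R L a b ((L a + L b) / 2) (ltW ab) cL.
    by rewrite min_l// max_r//; apply/andP; split; lra.
  have Lab2 : L a < L b by rewrite lt_neqAle Lab' Lab.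
  exists c; last first.
    move=> t; rewrite in_itv/= => /andP[at_ tb].
    have := Lmono a t (lexx _) at_ tb; have := Lmono t b at_ tb (lexx _).
    by move=> ? ?; rewrite ler_norml; apply/andP; split; lra.
  move: cab; rewrite !in_itv/= => /andP[ac cb]; rewrite !lt_neqAle ac cb !andbT.
  apply/andP; split; apply/eqP => E; move: Lc Lab2; [rewrite -E|rewrite E]; clear; lra.
move: (cab); rewrite in_itv/= => /andP[ac cb].
have Gge0 t : t \in `[a, b] -> 0 <= cos (Th t - Th c).
  move=> tab; apply: cos_ge0_pihalf; rewrite -ler_norml.
  move: (tab) => /Lc; move: tab; rewrite in_itv/= => /andP[at_ tb].
  apply: le_trans; have [tc|ct] := leP t c.
    by rewrite distrC [leRHS]distrC (le_trans (ThL _ _ at_ tc (ltW cb)))// ler_norm.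
  by rewrite (le_trans (ThL _ _ (ltW ac) (ltW ct) tb))// ler_norm.
(* [(p, q)] is the point of the circle at parameter [c], and [H] is a primitive of the component of
   the curve in that direction, which is nonnegative on the half circle. *)
pose p := A * cos (Th c) - B * sin (Th c).
pose q := B * cos (Th c) + A * sin (Th c).
pose H := (fun t => p * PX t + q * PY t).
have dH t : t \in `[a, b] -> is_derive t 1 H (cos (Th t - Th c)).
  move=> tab; have -> : cos (Th t - Th c) = p * X t + q * Y t.
    rewrite XE// YE// cosB /p /q.
    transitivity ((A ^+ 2 + B ^+ 2) * (cos (Th t) * cos (Th c) + sin (Th t) * sin (Th c))).
      by rewrite AB mul1r.
    ring.
  have dx := dPX _ (abD _ tab); have dy := dPY _ (abD _ tab).
  exact: (is_deriveD (is_deriveZ p dx) (is_deriveZ q dy)).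
have cG : {for c, continuous (fun t => cos (Th t - Th c))}.
  have dc := dTh _ (abD _ (subset_itv_oo_cc cab)).
  apply: (@continuous_comp _ _ _ (fun t => Th t - Th c) cos); last exact: continuous_cos.
  by apply: cvgB; [exact: is_derive_continuous dc|exact: cvg_cst].
have : \forall t \near c, 0 < cos (Th t - Th c)
  by apply: (cvgr_gt (cos (Th c - Th c)) cG); rewrite subrr cos0.
move=> /nbhs_ballP[d /= d0 dP].
(* At [c] the component equals 1, so it is positive just to the right of [c]; there the
   nondecreasing [H] strictly increases, against [H a = H b]. *)
pose c' := Num.min b (c + d / 2).
have cc' : c < c' by rewrite lt_min cb/= ltrDl divr_gt0.
have c'b : c' <= b by rewrite ge_min lexx.
have c'd : c' <= c + d / 2 by rewrite ge_min lexx orbT.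
have [z zab HE] : exists2 z, z \in `]c, c'[ & H c' - H c = cos (Th z - Th c) * (c' - c).
  apply: (MVT_on dH) => //.
  by apply: subset_itv; rewrite bnd_simp// ltW.
move: zab; rewrite in_itv/= => /andP[cz zc'].
have : 0 < cos (Th z - Th c).
  apply: dP; rewrite -ball_normE/= distrC gtr0_norm ?subr_gt0//; lra.
have Hm u v : a <= u -> u <= v -> v <= b -> H u <= H v.
  move=> au uv vb; have uvab : `[u, v] `<=` `[a, b] by apply: subset_itv; rewrite bnd_simp.
  by apply: (derive_ge0_le dH) => // t /uvab; exact: Gge0.
have := Hm a c (lexx _) (ltW ac) (ltW cb).
have := Hm c' b (le_trans (ltW ac) (ltW cc')) c'b (lexx _).
have : H a = H b by rewrite /H PX0 PY0.
have : 0 < c' - c by rewrite subr_gt0.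
move=> h1 h2 h3 h4 h5; have := mulr_gt0 h5 h1; rewrite -HE; lra.
Qed.

End circle_paths.

(** * Functions on the unit interval and their extensions to the line *)

Section unit_interval_paths.
Context {R : realType}.
Local Notation mu := (@lebesgue_measure R).
Local Notation I := (unit_interval R).
Implicit Types (f g : I -> R[i]) (z w : R[i]).

Lemma normC_Re z : `|complex.Re z| <= normC z.
Proof.
by case: z => a b; rewrite /normC/= -sqrtr_sqr ler_wsqrtr// lerDl sqr_ge0.
Qed.

Lemma normC_Im z : `|complex.Im z| <= normC z.
Proof.
by case: z => a b; rewrite /normC/= -sqrtr_sqr ler_wsqrtr// lerDr sqr_ge0.
Qed.

Lemma normC_ReIm z : normC z <= `|complex.Re z| + `|complex.Im z|.
Proof.
case: z => a b; rewrite /normC/= -[leRHS]ger0_norm ?addr_ge0// -sqrtr_sqr ler_wsqrtr//.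
rewrite sqrrD !real_normK ?num_real// lerD2r lerDl mulrn_wge0// mulr_ge0//.
Qed.

Lemma normC_sqr z : normC z ^+ 2 = complex.Re z ^+ 2 + complex.Im z ^+ 2.
Proof. by case: z => a b; rewrite /normC/= sqr_sqrtr// addr_ge0 ?sqr_ge0. Qed.

Lemma normC_ge0 z : 0 <= normC z.
Proof. by case: z => a b; exact: sqrtr_ge0. Qed.

Lemma normC0 : normC (0 : R[i]) = 0.
Proof. exact: ComplexField.Normc.normc0. Qed.

Lemma normC_dist z w : normC (z - w) = normC (w - z).
Proof. by rewrite -opprB; exact: normcN. Qed.

Lemma ltc_normC z (e : R) : (`|z| < (e%:C)%C) = (normC z < e).
Proof. by rewrite -[`|z|]/((normC z)%:C)%C ltcR. Qed.

Lemma ReB z w : complex.Re (z - w) = complex.Re z - complex.Re w.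
Proof. by case: z; case: w. Qed.

Lemma ImB z w : complex.Im (z - w) = complex.Im z - complex.Im w.
Proof. by case: z; case: w. Qed.

Lemma divC_real z (r : R) :
  z / (r%:C)%C = (complex.Re z / r +i* (complex.Im z / r))%C.
Proof.
rewrite -fmorphV; case: z => a b; apply/eqP; rewrite eq_complex/=.
by rewrite !mulr0 subr0 add0r !eqxx.
Qed.

Lemma cvgC_eps (T : Type) (F : set_system T) (h : T -> R[i]) (l : R[i]) : Filter F ->
  (h @ F --> l) <-> forall e : R, 0 < e -> \forall t \near F, normC (l - h t) < e.
Proof.
move=> FF; split=> [/cvgrPdist_lt H e e0|H].
  have e0' : 0 < ((e%:C)%C : R[i]) by rewrite ltcR.
  by apply: filterS (H _ e0') => t; rewrite ltc_normC.
apply/cvgrPdist_lt => e e0.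
have eE : e = ((normC e)%:C)%C by rewrite -[LHS]gtr0_norm.
rewrite eE -[X in _ < X]/(((normC e)%:C)%C) in e0 *.
rewrite ltcR in e0.
by apply: filterS (H _ e0) => t; rewrite ltc_normC.
Qed.

Definition clamp (t : R) : R := Num.max 0 (Num.min 1 t).

Lemma clamp_itv t : clamp t \in (`[0, 1]%classic : set R).
Proof.
by rewrite inE/= in_itv/= /clamp le_max lexx/= ge_max ler01 ge_min lexx.
Qed.

Definition proj01 (t : R) : I := SigSub (clamp_itv t).

Lemma clampK t : t \in `[0, 1] -> clamp t = t.
Proof. by rewrite in_itv/= /clamp => /andP[t0 t1]; rewrite min_r// max_r. Qed.

Lemma val_proj01 t : t \in `[0, 1] -> val (proj01 t) = t.
Proof. exact: clampK. Qed.

Lemma clamp_dist s t : `|clamp s - clamp t| <= `|s - t|.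
Proof.
wlog st : s t / s <= t.
  move=> H; have [|/ltW] := leP s t; first exact: H.
  by move=> /H; rewrite distrC (distrC t).
rewrite distrC (distrC s) [leRHS]ger0_norm ?subr_ge0//.
have clampE r : (r <= 0 /\ clamp r = 0) \/ (0 <= r <= 1 /\ clamp r = r) \/
    (1 <= r /\ clamp r = 1).
  rewrite /clamp; have [r0|/ltW r0] := leP r 0.
    by left; split => //; rewrite max_l// ge_min r0 orbT.
  right; have [r1|/ltW r1] := leP r 1; [left|right]; split => //.
  - by rewrite andbT.
  - by rewrite max_r.
  - by rewrite max_r.
rewrite ler_norml; case: (clampE s) => [[h ->]|[[/andP[h h'] ->]|[h ->]]];
  case: (clampE t) => [[k ->]|[[/andP[k k'] ->]|[k ->]]]; apply/andP; split; lra.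
Qed.

Lemma continuous01P f : continuous f <->
  forall t (e : R), 0 < e -> exists2 d, 0 < d & forall s : I,
    `|val t - val s| < d -> normC (f t - f s) < e.
Proof.
split=> [cf t e e0|H t].
  by have /cvgC_eps/(_ e e0)/unit_interval_nbhsP := cf t.
apply/(@cvgC_eps _ (nbhs t) f (f t) (nbhs_filter t)) => e e0.
by apply/unit_interval_nbhsP; exact: H.
Qed.

(** Extending by the end values keeps continuity, unlike the extension by zero in [L1norm], and
    makes calculus on the whole line available. [F] will be a real part, an imaginary part or a
    modulus. *)
Definition extend01 (F : R[i] -> R) f (t : R) : R := F (f (proj01 t)).

Lemma continuous_extend01 (F : R[i] -> R) f :
  (forall z w, `|F z - F w| <= normC (z - w)) -> continuous f ->
  continuous (extend01 F f).
Proof.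
move=> FL /continuous01P cf t; apply/cvgrPdist_lt => e e0.
have [d d0 dP] := cf (proj01 t) e e0.
apply/nbhs_ballP; exists d => //= s ts.
apply: le_lt_trans (FL _ _) (dP _ _).
exact: le_lt_trans (clamp_dist _ _) ts.
Qed.

Lemma Re_lip z w : `|complex.Re z - complex.Re w| <= normC (z - w).
Proof. by rewrite -ReB normC_Re. Qed.

Lemma Im_lip z w : `|complex.Im z - complex.Im w| <= normC (z - w).
Proof. by rewrite -ImB normC_Im. Qed.

Lemma normC_lip z w : `|normC z - normC w| <= normC (z - w).
Proof.
have H (a b : R[i]) : normC a <= normC (a - b) + normC b.
  by rewrite -{1}(subrK b a); exact: le_normcD.
have := H z w; have := H w z; rewrite normC_dist ler_norml => h1 h2.
by move: h1 h2; clear; move=> h1 h2; apply/andP; split; lra.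
Qed.

Lemma derivable01P f t (l : R[i]) :
  (diffquot f t s @[s --> t^'] --> l) <->
  forall e : R, 0 < e -> exists2 d, 0 < d & forall s : I,
    val s != val t -> `|val t - val s| < d -> normC (l - diffquot f t s) < e.
Proof.
split=> [/cvgC_eps H e e0|H].
  have /unit_interval_nbhsP[d d0 dP] := H e e0.
  by exists d => // s st ts; exact: dP.
apply/cvgC_eps => e e0; have [d d0 dP] := H e e0.
by apply/unit_interval_nbhsP; exists d => // s ts st; exact: dP.
Qed.

Lemma deriv01P f t : derivable01 f ->
  diffquot f t s @[s --> t^'] --> deriv01 f t.
Proof. by move=> /(_ t). Qed.

Lemma is_derive_extend01 (F : R[i] -> R) f (t : R) : derivable01 f ->
  (forall z w, `|F z - F w| <= normC (z - w)) ->
  (forall z w, F (z - w) = F z - F w) ->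
  (forall z (r : R), F (z / (r%:C)%C) = F z / r) ->
  0 < t < 1 ->
  is_derive t 1 (extend01 F f) (extend01 F (deriv01 f) t).
Proof.
move=> df FL FB Fdiv /andP[t0 t1]; apply/is_derive_epsP => e e0.
have t01 : t \in `[0, 1] by rewrite in_itv/= !ltW.
have := @deriv01P f (proj01 t) df; move=> /derivable01P/(_ e e0)[d d0 dP].
pose d' := Num.min d (Num.min t (1 - t)).
exists d'; first by rewrite !lt_min d0 t0 subr_gt0 t1.
move=> h h0; rewrite !lt_min => /and3P[hd ht h1].
have th01 : t + h \in `[0, 1].
  rewrite in_itv/=; move: ht h1; rewrite !ltr_norml => /andP[? ?] /andP[? ?].
  by apply/andP; split; lra.
have := dP (proj01 (t + h)); rewrite !val_proj01//.
rewrite -subr_eq0 addrAC subrr add0r => /(_ h0).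
rewrite opprD addrA subrr add0r normrN => /(_ hd).
apply: le_lt_trans; rewrite distrC.
apply: le_trans (FL _ _); rewrite /diffquot !val_proj01// Fdiv FB.
by rewrite [t + h - t]addrAC subrr add0r.
Qed.

Lemma L1normE f : L1norm f =
  (\int[mu]_(t in `[0%R, 1%R]) (normC (f (proj01 t)))%:E)%E.
Proof.
apply: eq_integral => t /set_mem tI; congr (_%:E).
have tA : t \in (`[0, 1]%classic : set R) by exact/mem_set.
have -> : 'valL_0 (@normC R \o f) t = normC (f (SigSub tA)).
  by have := congr1 (fun u => u (SigSub tA)) (@valLK _ _ 0 _ (@normC R \o f)).
by congr (normC (f _)); apply: val_inj => /=; rewrite clampK.
Qed.

Lemma L1norm_unit f : (forall t, normC (f t) = 1) -> L1norm f = 1%E.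
Proof.
move=> f1; rewrite L1normE; under eq_integral do rewrite f1.
by rewrite integral_cst//= lebesgue_measure_itv/= lte_fin ltr01 mul1e oppr0 adde0.
Qed.

End unit_interval_paths.

(** * Angle function of an element of [Y] and its means over n intervals *)

Section no_vanishing_means.
Context {R : realType} {n : nat}.
Local Notation mu := (@lebesgue_measure R).
Variable f : Y R n.
Hypothesis n0 : (0 < n)%N.

Let X := extend01 (@complex.Re R) f.
Let Z := extend01 (@complex.Im R) f.
Let X' := extend01 (@complex.Re R) (deriv01 f).
Let Z' := extend01 (@complex.Im R) (deriv01 f).
(** Signed angular speed: for a curve of modulus 1 the derivative is [i r] times the curve. *)
Let r t := X t * Z' t - Z t * X' t.

Let df : derivable01 f. Proof. exact: (Y_smooth f 0%N). Qed.

Let cf : continuous f. Proof. exact: derivable01_continuous df. Qed.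

Let cf' : continuous (deriv01 f).
Proof. exact: derivable01_continuous (Y_smooth f 1%N). Qed.

Let cX : continuous X. Proof. exact: continuous_extend01 Re_lip cf. Qed.
Let cZ : continuous Z. Proof. exact: continuous_extend01 Im_lip cf. Qed.
Let cX' : continuous X'. Proof. exact: continuous_extend01 Re_lip cf'. Qed.
Let cZ' : continuous Z'. Proof. exact: continuous_extend01 Im_lip cf'. Qed.
Let cr : continuous r.
Proof.
by move=> t; apply: cvgB; apply: cvgM; [exact: cX|exact: cZ'|exact: cZ|exact: cX'].
Qed.

Let cnr : continuous (fun t => `|r t|).
Proof.
move=> t; apply: (@continuous_comp _ _ _ r Num.norm); first exact: cr.
exact: norm_continuous.
Qed.

Let XZ1 t : X t ^+ 2 + Z t ^+ 2 = 1.
Proof. by rewrite -normC_sqr Y_circle expr1n. Qed.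

Let dX (t : R) : 0 < t < 1 -> is_derive t 1 X (X' t).
Proof.
apply: is_derive_extend01 df Re_lip ReB _ => z s.
by rewrite divC_real.
Qed.

Let dZ (t : R) : 0 < t < 1 -> is_derive t 1 Z (Z' t).
Proof.
apply: is_derive_extend01 df Im_lip ImB _ => z s.
by rewrite divC_real.
Qed.

Let XX'ZZ' (t : R) : 0 < t < 1 -> X t * X' t + Z t * Z' t = 0.
Proof.
move=> t01.
have := is_deriveD (is_deriveX 2 (dX t01)) (is_deriveX 2 (dZ t01)).
have -> : X ^+ 2 + Z ^+ 2 = cst 1 by apply/funext => s; exact: XZ1.
move=> [_]; rewrite derive_cst !expr1 /GRing.scale/= => H; lra.
Qed.

Let XE (t : R) : 0 < t < 1 -> X' t = - r t * Z t.
Proof.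
move=> t01; have := XX'ZZ' t01; have := XZ1 t; rewrite /r => h1 h2.
transitivity (X' t * (X t ^+ 2 + Z t ^+ 2)); first by rewrite h1 mulr1.
transitivity (X t * (X t * X' t + Z t * Z' t) - (X t * Z' t - Z t * X' t) * Z t); first by ring.
by rewrite h2 mulr0 add0r mulNr.
Qed.

Let ZE (t : R) : 0 < t < 1 -> Z' t = r t * X t.
Proof.
move=> t01; have := XX'ZZ' t01; have := XZ1 t; rewrite /r => h1 h2.
transitivity (Z' t * (X t ^+ 2 + Z t ^+ 2)); first by rewrite h1 mulr1.
transitivity (Z t * (X t * X' t + Z t * Z' t) + (X t * Z' t - Z t * X' t) * X t); first by ring.
by rewrite h2 mulr0 add0r.
Qed.

Let r_le t : `|r t| <= normC (deriv01 f (proj01 t)).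
Proof.
rewrite -(@ler_pXn2r _ 2)// ?nnegrE ?normC_ge0// real_normK ?num_real// normC_sqr.
rewrite -/(X' t) -/(Z' t) -[leRHS]mul1r -(XZ1 t) /r -subr_ge0.
(* Lagrange's identity. *)
rewrite (_ : _ - _ = (X t * X' t + Z t * Z' t) ^+ 2); first exact: sqr_ge0.
ring.
Qed.

Let bound : (L1norm (deriv01 f) <= (pi * n%:R)%:E)%E.
Proof.
have := Y_bound f; rewrite /W11norm L1norm_unit; last exact: Y_circle.
by rewrite EFinD leeD2lE.
Qed.

Local Notation D := (`](-1 : R), 2[%classic : set R).

Let sub01 (a b : R) : 0 <= a -> b <= 1 -> `[a, b] `<=` D.
Proof.
move=> a0 b1 t; rewrite /= !in_itv/= => /andP[at_ tb].
by apply/andP; split; lra.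
Qed.

Lemma Y_means_neq0 : exists j : 'I_n,
  \int[mu]_(t in `[j%:R / n%:R, j.+1%:R / n%:R]) X t != 0 \/
  \int[mu]_(t in `[j%:R / n%:R, j.+1%:R / n%:R]) Z t != 0.
Proof.
have [Th dTh] := exists_primitive cr.
have [L dL] : exists L : R -> R, forall t : R, t \in `](-1), 2[ -> is_derive t 1 L `|r t|.
  exact: exists_primitive cnr.
have [PX dPX] := exists_primitive cX.
have [PZ dPZ] := exists_primitive cZ.
have oo (t : R) : 0 < t < 1 -> t \in `](-1 : R), 2[.
  by rewrite in_itv/= => /andP[? ?]; apply/andP; split; lra.
have dcos (t : R) : 0 < t < 1 -> is_derive t 1 (fun s => cos (Th s)) (- sin (Th t) * r t).
  by move=> /oo/dTh H; exact: is_derive_compf.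
have dsin (t : R) : 0 < t < 1 -> is_derive t 1 (fun s => sin (Th s)) (cos (Th t) * r t).
  by move=> /oo/dTh H; exact: is_derive_compf.
(* The extension by end values need not be differentiable at 0 and 1, so constancy on the closed
   interval combines derivatives inside with continuity at the ends. *)
have const0 (G : R -> R) : (forall t : R, 0 < t < 1 -> is_derive t 1 G 0) ->
    (forall t : R, t \in `[0, 1] -> {for t, continuous G}) ->
    forall t : R, t \in `[0, 1] -> G t = G 0.
  move=> dG cG t; rewrite in_itv/= => /andP[t0 t1].
  have [||c _] := @MVT_segment R G (fun=> 0) 0 t t0.
  - by move=> x; rewrite in_itv/= => /andP[x0 xt]; apply: dG; rewrite x0 (lt_le_trans xt).
  - apply: within_continuous => x; rewrite /= in_itv/= => /andP[x0 xt]; apply: cG.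
    by rewrite in_itv/= x0 (le_trans xt).
  by rewrite mul0r => /eqP; rewrite subr_eq0 => /eqP.
have cTh (t : R) : t \in `[0, 1] -> {for t, continuous Th}.
  move=> t01; apply: is_derive_continuous (dTh t _).
  exact: (sub01 (lexx 0) (lexx 1) t01).
have ccos (t : R) : t \in `[0, 1] -> {for t, continuous (fun s => cos (Th s))}.
  by move=> /cTh H; apply: (@continuous_comp _ _ _ Th cos) => //; exact: continuous_cos.
have csin (t : R) : t \in `[0, 1] -> {for t, continuous (fun s => sin (Th s))}.
  by move=> /cTh H; apply: (@continuous_comp _ _ _ Th sin) => //; exact: continuous_sin.
(* [A + iB] is the value at 0 of the curve times exp(-i Th). This product is constant, so [Th] is an
   angle function of the curve up to a fixed rotation. *)
pose A := X 0 * cos (Th 0) + Z 0 * sin (Th 0).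
pose B := Z 0 * cos (Th 0) - X 0 * sin (Th 0).
have EA : forall t : R, t \in `[0, 1] -> X t * cos (Th t) + Z t * sin (Th t) = A.
  apply: (const0 (fun t => X t * cos (Th t) + Z t * sin (Th t))) => [s s01|s s01].
    have H := is_derive_addf (is_derive_mulf (dX s01) (dcos s s01))
      (is_derive_mulf (dZ s01) (dsin s s01)).
    apply: (is_derive_eq H); rewrite XE// ZE//; ring.
  by apply: cvgD; apply: cvgM; [exact: cX|exact: ccos|exact: cZ|exact: csin].
have EB : forall t : R, t \in `[0, 1] -> Z t * cos (Th t) - X t * sin (Th t) = B.
  apply: (const0 (fun t => Z t * cos (Th t) - X t * sin (Th t))) => [s s01|s s01].
    have H := is_derive_subf (is_derive_mulf (dZ s01) (dcos s s01))
      (is_derive_mulf (dX s01) (dsin s s01)).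
    apply: (is_derive_eq H); rewrite XE// ZE//; ring.
  by apply: cvgB; apply: cvgM; [exact: cZ|exact: ccos|exact: cX|exact: csin].
have cs t : cos (Th t) ^+ 2 + sin (Th t) ^+ 2 = 1 by exact: cos2Dsin2.
have AB : A ^+ 2 + B ^+ 2 = 1.
  rewrite -(XZ1 0) -[RHS]mulr1 -(cs 0) /A /B; ring.
apply: contrapT => /forallNP H.
have n0' : 0 < n%:R :> R by rewrite ltr0n.
have step (j : 'I_n) : pi < L (j.+1%:R / n%:R) - L (j%:R / n%:R).
  have ab : (j%:R / n%:R : R) < j.+1%:R / n%:R.
    by rewrite ltr_pM2r ?invr_gt0// ltr_nat.
  have a0 : 0 <= (j%:R / n%:R : R) by rewrite divr_ge0.
  have b1 : (j.+1%:R / n%:R : R) <= 1 by rewrite ler_pdivrMr// mul1r ler_nat.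
  have abD := sub01 a0 b1.
  have ab01 (t : R) : t \in `[(j%:R / n%:R), (j.+1%:R / n%:R)] -> t \in `[0, 1].
    by rewrite !in_itv/= => /andP[at_ tb]; rewrite (le_trans a0)// (le_trans tb).
  have /not_orP[/negP/negbNE/eqP HX /negP/negbNE/eqP HZ] := H j.
  rewrite (Rintegral_primitive cX dPX ab abD) in HX.
  rewrite (Rintegral_primitive cZ dPZ ab abD) in HZ.
  apply: (short_arc_mean_neq0 dTh dL dPX dPZ AB ab abD).
  - move=> t /ab01 t01; rewrite -(EA t t01) -(EB t t01) -[LHS]mulr1 -(cs t); ring.
  - move=> t /ab01 t01; rewrite -(EA t t01) -(EB t t01) -[LHS]mulr1 -(cs t); ring.
  - lra.
  - lra.
have : (pi * n%:R < L 1 - L 0).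
  have -> : L 1 - L 0 = \sum_(0 <= j < n) (L (j.+1%:R / n%:R) - L (j%:R / n%:R)).
    by rewrite (@telescope_sumr _ 0 n (fun j => L (j%:R / n%:R)))// mul0r divff// gt_eqF.
  rewrite big_mkord mulr_natr -[X in _ *+ X]card_ord -sumr_const.
  (* Summing strict inequalities gives a strict one only over a nonempty range, which [n0]
     supplies. *)
  apply: ltr_sum => [|j _]; last exact: step.
  by have := mem_index_enum (Ordinal n0); case: (index_enum _).
apply/negP; rewrite -leNgt -lee_fin; apply: le_trans bound.
rewrite -(integral_primitive _ dL ltr01 (sub01 (lexx 0) (lexx 1))); last first.
  move=> t; exact: cnr.
rewrite L1normE; apply: ge0_le_integral => //=.
- exact: measurable_int (continuous_integrable 0 1 cnr).
- have cn := continuous_extend01 normC_lip cf'.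
  exact: measurable_int (continuous_integrable 0 1 cn).
- by move=> t _; rewrite lee_fin; exact: r_le.
Qed.

End no_vanishing_means.

(** * The odd map to 2n real coordinates and the upper bound *)

Section mean_functionals.
Context {R : realType} {n : nat}.
Local Notation mu := (@lebesgue_measure R).
Implicit Types f g : Y R n.

Lemma Y_continuous f : continuous f.
Proof. exact/smooth01_continuous/Y_smooth. Qed.

Lemma L1distE f g :
  L1dist f g = \int[mu]_(t in `[0, 1]) normC (f (proj01 t) - g (proj01 t)).
Proof. by rewrite /L1dist L1normE. Qed.

Definition mean (F : R[i] -> R) (a b : R) f : R :=
  \int[mu]_(t in `[a, b]) extend01 F f t.

Lemma mean_dist (F : R[i] -> R) (a b : R) f g :
  (forall z w : R[i], `|F z - F w| <= normC (z - w)) -> 0 <= a -> b <= 1 ->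
  `|mean F a b f - mean F a b g| <= L1dist f g.
Proof.
move=> FL a0 b1; have abI : `[a, b] `<=` (`[0, 1]%classic : set R).
  by apply: subset_itv; rewrite bnd_simp.
have cF (h : Y R n) : continuous (extend01 F h) by exact: continuous_extend01 FL (@Y_continuous h).

have cFB : continuous (fun t => extend01 F f t - extend01 F g t).
  by move=> t; apply: cvgB; exact: cF.
have cN : continuous (fun t => `|extend01 F f t - extend01 F g t|).
  move=> t; apply: (@continuous_comp _ _ _ (fun t => extend01 F f t - extend01 F g t) Num.norm).
    exact: cFB.
  exact: norm_continuous.
have cC : continuous (extend01 (@normC R) (f \- g)).
  apply: (continuous_extend01 normC_lip) => t.
  exact: (cvgB (@Y_continuous f t) (@Y_continuous g t)).
rewrite /mean -RintegralB//;
  [|exact: continuous_integrable (cF f)|exact: continuous_integrable (cF g)].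
apply: le_trans (le_normr_Rintegral _ (continuous_integrable a b cFB)) _ => //.
apply: (@le_trans _ _ (\int[mu]_(t in `[a, b]) extend01 (@normC R) (f \- g) t)).
  apply: le_Rintegral => //; [exact: continuous_integrable cN|exact: continuous_integrable cC|].
  by move=> t _; exact: FL.
rewrite L1distE /Rintegral; apply: fine_le.
- exact: integrable_fin_num (continuous_integrable a b cC).
- exact: integrable_fin_num (continuous_integrable 0 1 cC).
apply: ge0_subset_integral => //.
- exact: measurable_int (continuous_integrable 0 1 cC).
- by move=> t _; rewrite lee_fin; exact: normC_ge0.
Qed.

Lemma mean_continuous (F : R[i] -> R) (a b : R) :
  (forall z w : R[i], `|F z - F w| <= normC (z - w)) -> 0 <= a -> b <= 1 ->
  continuous (mean F a b : Y R n -> R).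
Proof.
move=> FL a0 b1 f; apply/(@cvgrPdist_lt _ _ _ _ (nbhs_filter f)) => e e0.
apply/nbhs_ballP; exists e => //= g fg.
exact: le_lt_trans (mean_dist f g FL a0 b1) fg.
Qed.

Lemma mean_Yopp (F : R[i] -> R) (a b : R) f : (forall z, F (- z) = - F z) ->
  (forall z w : R[i], `|F z - F w| <= normC (z - w)) ->
  mean F a b (Yopp R n f) = - mean F a b f.
Proof.
move=> FN FL; rewrite -mulN1r -RintegralZl//; last first.
  exact: continuous_integrable (continuous_extend01 FL (@Y_continuous f)).
by apply: eq_Rintegral => t _; rewrite mulN1r -FN.
Qed.

End mean_functionals.

Lemma equivariant_sphere_le (R : realType) n k : (0 < n)%N ->
  equivariant_from_sphere R (Yopp R n) k -> (k <= 2 * n - 1)%N.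
Proof.
move=> n0 [f [cf fN]]; rewrite leqNgt; apply/negP => kn.
have nk : (n + n <= k)%N by move: kn; rewrite mul2n -addnn subn1 prednK// addn_gt0 n0.
pose g (j : 'I_(n + n)) (x : sphere R k) : R := match fintype.split j with
  | inl i => mean (@complex.Re R) (i%:R / n%:R) (i.+1%:R / n%:R) (f x)
  | inr i => mean (@complex.Im R) (i%:R / n%:R) (i.+1%:R / n%:R) (f x)
  end.
have n0' : 0 < n%:R :> R by rewrite ltr0n.
have i0 (i : 'I_n) : 0 <= (i%:R / n%:R : R) by rewrite divr_ge0.
have i1 (i : 'I_n) : (i.+1%:R / n%:R : R) <= 1 by rewrite ler_pdivrMr// mul1r ler_nat.
have [||x gx] := borsuk_ulam (g := g) nk.
- move=> j x; rewrite /g; case: (fintype.split j) => i.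
  + apply: (@continuous_comp _ _ _ f (mean (@complex.Re R) (i%:R / n%:R) (i.+1%:R / n%:R))).
      exact: cf.
    exact: mean_continuous Re_lip (i0 i) (i1 i) _.
  + apply: (@continuous_comp _ _ _ f (mean (@complex.Im R) (i%:R / n%:R) (i.+1%:R / n%:R))).
      exact: cf.
    exact: mean_continuous Im_lip (i0 i) (i1 i) _.
- move=> j x; rewrite /g; case: (fintype.split j) => i; rewrite fN mean_Yopp//.
  + by case.
  + exact: Re_lip.
  + by case.
  + exact: Im_lip.
have [j] := Y_means_neq0 (f x) n0.
have := gx (lshift n j); have := gx (rshift n j).
rewrite /g (unsplitK (inl j)) (unsplitK (inr j)) /mean => -> ->.
by rewrite eqxx; case.
Qed.

(** * Smooth functions *)

Section smooth_functions.
Context {R : realType}.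
Implicit Types (f g : R -> R).

(** Curves are constructed on the whole line with two-sided derivatives, and only then restricted to
    the unit interval, where the derivatives at the ends are one-sided. *)
Fixpoint Cn (m : nat) f : Prop :=
  if m is m'.+1 then
    exists f' : R -> R, (forall t : R, is_derive t 1 f (f' t)) /\ Cn m' f'
  else continuous f.

Definition smooth f := forall m, Cn m f.

Lemma Cn_continuous m f : Cn m f -> continuous f.
Proof. by case: m => // m [f' [df _]] t; exact: is_derive_continuous (df t). Qed.

Lemma CnS m f : Cn m.+1 f -> Cn m f.
Proof.
elim: m f => [|m IH] f; first exact: Cn_continuous.
by move=> [f' [df cf']]; exists f'; split => //; exact: IH.
Qed.

Lemma Cn_cst m (c : R) : Cn m (fun=> c).
Proof.
elim: m c => [|m IH] c; first by move=> t; exact: cvg_cst.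
by exists (fun=> 0); split => // t; exact: is_derive_cst.
Qed.

Lemma CnD m f g : Cn m f -> Cn m g -> Cn m (fun t => f t + g t).
Proof.
elim: m f g => [|m IH] f g; first by move=> cf cg t; apply: cvgD; [exact: cf|exact: cg].
move=> [f' [df cf]] [g' [dg cg]]; exists (fun t => f' t + g' t); split; last exact: IH.
by move=> t; exact: is_derive_addf.
Qed.

Lemma CnM m f g : Cn m f -> Cn m g -> Cn m (fun t => f t * g t).
Proof.
elim: m f g => [|m IH] f g; first by move=> cf cg t; apply: cvgM; [exact: cf|exact: cg].
move=> Cf Cg; have [f' [df cf]] := Cf; have [g' [dg cg]] := Cg.
exists (fun t => f' t * g t + f t * g' t); split.
  by move=> t; exact: is_derive_mulf.
by apply: CnD; apply: IH => //; exact: CnS.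
Qed.

Lemma is_derive_invf f (t a : R) : f t != 0 -> is_derive t 1 f a ->
  is_derive t 1 (fun s => (f s)^-1) (- 1 * a * ((f t)^-1 * (f t)^-1)).
Proof.
move=> f0 df; apply: (is_derive_eq (is_deriveV f0 df)).
by rewrite /GRing.scale/= -exprVn expr2; ring.
Qed.

Lemma CnV m f : (forall t, f t != 0) -> Cn m f -> Cn m (fun t => (f t)^-1).
Proof.
move=> f0; elim: m => [|m IH]; first by move=> cf t; apply: cvgV; [exact: f0|exact: cf].
move=> Cf; have [f' [df cf]] := Cf.
exists (fun t => - 1 * f' t * ((f t)^-1 * (f t)^-1)); split.
  by move=> t; exact: is_derive_invf.
have CI := IH (CnS Cf).
by apply: CnM; [apply: CnM => //; exact: Cn_cst|exact: CnM].
Qed.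

Lemma smooth_derive f : smooth f ->
  exists f', smooth f' /\ forall t : R, is_derive t 1 f (f' t).
Proof.
move=> sf; have [f' [df _]] := sf 1%N; exists f'; split => // m.
have [g [dg cg]] := sf m.+1.
suff -> : f' = g by [].
by apply/funext => t; have [_ <-] := df t; have [_ <-] := dg t.
Qed.

(** Bootstrapping: the derivatives are products of [r] with the functions themselves, so each order
    of smoothness yields the next. Smoothness of a curve in the circle thus reduces to that of its
    angular speed. *)
Lemma Cn_rotation m (r X Z : R -> R) : smooth r ->
  (forall t : R, is_derive t 1 X (- 1 * (r t * Z t))) ->
  (forall t : R, is_derive t 1 Z (r t * X t)) -> Cn m X /\ Cn m Z.
Proof.
move=> sr dX dZ; elim: m => [|m [CX CZ]].
  by split=> t; [exact: is_derive_continuous (dX t)|exact: is_derive_continuous (dZ t)].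
split; [exists (fun t => - 1 * (r t * Z t))|exists (fun t => r t * X t)]; split => //.
  by apply: CnM; [exact: Cn_cst|exact: CnM].
exact: CnM.
Qed.

End smooth_functions.

Section restriction_to_unit_interval.
Context {R : realType}.
Local Notation I := (unit_interval R).
Local Open Scope complex_scope.

Definition restrict01 (f : R -> R[i]) (s : I) : R[i] := f (val s).

Lemma restrict01_derive (a b a' b' : R -> R) :
  (forall t : R, is_derive t 1 a (a' t)) -> (forall t : R, is_derive t 1 b (b' t)) ->
  derivable01 (restrict01 (fun t => a t +i* b t)) /\
  deriv01 (restrict01 (fun t => a t +i* b t)) = restrict01 (fun t => a' t +i* b' t).
Proof.
move=> da db.
have C (t : I) : diffquot (restrict01 (fun t => a t +i* b t)) t s @[s --> t^'] -->
    restrict01 (fun t => a' t +i* b' t) t.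
  apply/derivable01P => e e0; have e20 : 0 < e / 2 by rewrite divr_gt0.
  have [d1 d10 H1] := (is_derive_epsP _ _ _).1 (da (val t)) _ e20.
  have [d2 d20 H2] := (is_derive_epsP _ _ _).1 (db (val t)) _ e20.
  exists (Num.min d1 d2); first by rewrite lt_min d10.
  move=> s st; rewrite lt_min distrC => /andP[s1 s2].
  have st0 : val s - val t != 0 by rewrite subr_eq0.
  have := H1 _ st0 s1; have := H2 _ st0 s2.
  have -> : val t + (val s - val t) = val s by rewrite addrC subrK.
  rewrite /diffquot divC_real /restrict01 => h2 h1.
  apply: le_lt_trans (normC_ReIm _) _; rewrite ReB ImB/= [X in X + _]distrC [X in _ + X]distrC.
  by rewrite (splitr e) ltrD.
split=> [t|]; first by apply/cvg_ex; exists (restrict01 (fun t => a' t +i* b' t) t); exact: C.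
apply/funext => t; have tP := dnbhs_unit_interval_proper t.
by apply/cvg_lim => //; exact: C.
Qed.

Lemma restrict01_smooth (a b : R -> R) : smooth a -> smooth b ->
  smooth01 (restrict01 (fun t => a t +i* b t)).
Proof.
move=> sa sb k; elim: k a b sa sb => [|k IH] a b sa sb.
  have [a' [_ da]] := smooth_derive sa; have [b' [_ db]] := smooth_derive sb.
  by have [] := restrict01_derive da db.
have [a' [sa' da]] := smooth_derive sa; have [b' [sb' db]] := smooth_derive sb.
by rewrite iterSr (restrict01_derive da db).2; exact: IH.
Qed.

End restriction_to_unit_interval.

(** * Loops in the circle with nonnegative angular speed *)

Section unwinding.
Context {R : realType}.
Local Open Scope complex_scope.
Implicit Types (f g : R -> R[i]) (r : R -> R).

(* [f' = i r f] and [|f| = 1]. *)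
Definition turning r f := [/\ forall t, normC (f t) = 1,
  forall t : R, is_derive t 1 (fun s => complex.Re (f s)) (- 1 * (r t * complex.Im (f t))) &
  forall t : R, is_derive t 1 (fun s => complex.Im (f s)) (r t * complex.Re (f t))].

(** Since the speed is nonnegative, the total variation is the total turning, which adds up under
    products and is not increased by disc automorphisms. The condition [f 1 = f 0] is what makes the
    phase correction in [disc_aut_unwinding] cancel. *)
Definition unwinding (k : nat) r f := [/\ turning r f, smooth r,
  forall t, 0 <= r t, f 1 = f 0 &
  exists P : R -> R, (forall t : R, is_derive t 1 P (r t)) /\ P 1 - P 0 <= 2 * pi * k%:R].

Lemma unwinding_le k l r f : (k <= l)%N -> unwinding k r f -> unwinding l r f.
Proof.
move=> kl [tf sr r0 f01 [P [dP Pk]]]; split => //; exists P; split => //.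
apply: le_trans Pk _; rewrite ler_wpM2l ?ler_nat// mulr_ge0// pi_ge0//.
Qed.

Lemma unwinding_cst (c : R[i]) : normC c = 1 -> unwinding 0 (fun=> 0) (fun=> c).
Proof.
move=> c1; split => //.
- by split => // t; apply: (is_derive_eq (is_derive_cst _ _ _)); rewrite !mul0r ?mulr0.
- by move=> m; exact: Cn_cst.
- by exists (fun=> 0); split; [move=> t; exact: is_derive_cst|rewrite subrr mulr0].
Qed.

Lemma ReM (z w : R[i]) :
  complex.Re (z * w) = complex.Re z * complex.Re w - complex.Im z * complex.Im w.
Proof. by case: z; case: w. Qed.

Lemma ImM (z w : R[i]) :
  complex.Im (z * w) = complex.Re z * complex.Im w + complex.Im z * complex.Re w.
Proof. by case: z; case: w. Qed.

Lemma normCM (z w : R[i]) : normC (z * w) = normC z * normC w.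
Proof. exact: ComplexField.Normc.normcM. Qed.

Lemma unwindingM k l r s f g : unwinding k r f -> unwinding l s g ->
  unwinding (k + l) (fun t => r t + s t) (fun t => f t * g t).
Proof.
move=> [[f1 dRf dIf] sr r0 f01 [P [dP Pk]]] [[g1 dRg dIg] ss s0 g01 [Q [dQ Ql]]].
split.
- split=> t; first by rewrite normCM f1 g1 mulr1.
  + under [X in is_derive _ _ X]eq_fun do rewrite ReM.
    apply: (is_derive_eq (is_derive_subf (is_derive_mulf (dRf t) (dRg t))
      (is_derive_mulf (dIf t) (dIg t)))); rewrite ImM; ring.
  + under [X in is_derive _ _ X]eq_fun do rewrite ImM.
    apply: (is_derive_eq (is_derive_addf (is_derive_mulf (dRf t) (dIg t))
      (is_derive_mulf (dIf t) (dRg t)))); rewrite ReM; ring.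
- by move=> m; exact: CnD.
- by move=> t; rewrite addr_ge0.
- by rewrite f01 g01.
- exists (fun t => P t + Q t); split; first by move=> t; exact: is_derive_addf.
  by rewrite natrD mulrDr; lra.
Qed.

Definition unit_loop (t : R) : R[i] := cos (2 * pi * t) +i* sin (2 * pi * t).

Lemma is_derive_scalef (c t : R) : is_derive t 1 (fun s => c * s) c.
Proof.
have H := is_derive_mulf (@is_derive_cst _ _ _ c t 1) (is_derive_id t 1).
by apply: (is_derive_eq H); rewrite mul0r add0r mulr1.
Qed.

Lemma unwinding_unit_loop : unwinding 1 (fun=> 2 * pi) unit_loop.
Proof.
split.
- split=> t.
  + by rewrite /normC/= cos2Dsin2 sqrtr1.
  + apply: (is_derive_eq (is_derive_compf (is_derive_cos _) (is_derive_scalef (2 * pi) t))).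
    by rewrite /unit_loop/=; ring.
  + apply: (is_derive_eq (is_derive_compf (is_derive_sin _) (is_derive_scalef (2 * pi) t))).
    by rewrite /unit_loop/=; ring.
- by move=> m; exact: Cn_cst.
- by move=> t; rewrite mulr_ge0// pi_ge0.
- rewrite /unit_loop mulr1 mulr0 cos0 sin0 mulr_natl.
  by rewrite cos2pi sin2pi.
- exists (fun t => 2 * pi * t); split; last by rewrite mulr0 subr0.
  by move=> t; exact: is_derive_scalef.
Qed.

End unwinding.

(** * Finite Blaschke products *)

Section disc_automorphism.
Context {R : realType}.
Local Open Scope complex_scope.

Section rotating_quotient.
Variables (N s : R) (p q W1 W2 : R -> R) (t : R).
Hypothesis dp : is_derive t 1 p (- 1 * (s * q t)).
Hypothesis dq : is_derive t 1 q (s * p t).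
Hypothesis dW1 : is_derive t 1 W1 (- 1 * (s * W2 t)).
Hypothesis dW2 : is_derive t 1 W2 (s * (W1 t - N)).
Hypothesis W10 : 0 < W1 t.

Let D u := W1 u * W1 u + W2 u * W2 u.

Let D0 : D t != 0.
Proof. by rewrite gt_eqF// /D -!expr2 ltr_pwDl ?exprn_gt0// sqr_ge0. Qed.

Let dD := is_derive_addf (is_derive_mulf dW1 dW1) (is_derive_mulf dW2 dW2).
Let dDV := is_derive_invf D0 dD.
Let dC := is_derive_subf (is_derive_mulf dW1 dW1) (is_derive_mulf dW2 dW2).
Let dS := is_derive_mulf dW1 dW2.

(** Put v = p + iq and W = W1 + iW2, with W the denominator of the automorphism. On the unit circle
    the numerator is v conj(W), so the automorphism is v conj(W)^2 / |W|^2; this lemma and the next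
    treat its real and imaginary parts. *)
Lemma is_derive_quotient_Re :
  is_derive t 1 (fun u => (p u * (W1 u * W1 u - W2 u * W2 u) +
      (q u * (W1 u * W2 u) + q u * (W1 u * W2 u))) * (D u)^-1)
    (- 1 * (s * ((2 * N * W1 t - D t) / D t) *
     ((q t * (W1 t * W1 t - W2 t * W2 t) -
      (p t * (W1 t * W2 t) + p t * (W1 t * W2 t))) * (D t)^-1))).
Proof.
have H := is_derive_mulf (is_derive_addf (is_derive_mulf dp dC)
  (is_derive_addf (is_derive_mulf dq dS) (is_derive_mulf dq dS))) dDV.
by apply: (is_derive_eq H); have := D0; rewrite /D => ?; field.
Qed.

Lemma is_derive_quotient_Im :
  is_derive t 1 (fun u => (q u * (W1 u * W1 u - W2 u * W2 u) -
      (p u * (W1 u * W2 u) + p u * (W1 u * W2 u))) * (D u)^-1)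
    (s * ((2 * N * W1 t - D t) / D t) *
     ((p t * (W1 t * W1 t - W2 t * W2 t) +
      (q t * (W1 t * W2 t) + q t * (W1 t * W2 t))) * (D t)^-1)).
Proof.
have H := is_derive_mulf (is_derive_subf (is_derive_mulf dq dC)
  (is_derive_addf (is_derive_mulf dp dS) (is_derive_mulf dp dS))) dDV.
by apply: (is_derive_eq H); have := D0; rewrite /D => ?; field.
Qed.

(** The argument of v conj(W) / W is that of v minus twice that of W, and [W10] makes the arctangent
    of W2 / W1 an argument of W. *)
Lemma is_derive_quotient_phase (P : R -> R) : is_derive t 1 P s ->
  is_derive t 1 (fun u => P u - 2 * atan (W2 u * (W1 u)^-1))
    (s * ((2 * N * W1 t - D t) / D t)).
Proof.
move=> dP; have W10' : W1 t != 0 by rewrite gt_eqF.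
have dA := is_derive_compf (is_derive1_atan _) (is_derive_mulf dW2 (is_derive_invf W10' dW1)).
have H := is_derive_subf dP (is_derive_mulf (is_derive_cst (2 : R) t (1 : R)) dA).
apply: (is_derive_eq H); have := D0; rewrite /D => D0'.
by field; rewrite W10' D0'.
Qed.

End rotating_quotient.

(* [disc_aut z N] is the automorphism of the unit disc with parameter [z / N]. *)
Definition disc_den (z : R[i]) (N : R) (v : R[i]) : R[i] := N%:C + conjc z * v.

Definition disc_aut (z : R[i]) (N : R) (v : R[i]) : R[i] :=
  (z + N%:C * v) / disc_den z N v.

Lemma normCV (z : R[i]) : normC z^-1 = (normC z)^-1.
Proof. exact: ComplexField.Normc.normcV. Qed.

Lemma normC_conjc (z : R[i]) : normC (conjc z) = normC z.
Proof. by case: z => a b; rewrite /normC/= sqrrN. Qed.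

Lemma normC_real (r : R) : normC (r%:C) = `|r|.
Proof. by rewrite /normC/= expr0n addr0 sqrtr_sqr. Qed.

Lemma le_normCB (z w : R[i]) : normC z - normC w <= normC (z + w).
Proof.
rewrite lerBlDr -[normC w]normcN.
by apply: le_trans (le_normcD _ _); rewrite addrK.
Qed.

Lemma disc_den_ge (z : R[i]) (N : R) v : normC v = 1 -> 0 <= N ->
  N - normC z <= normC (disc_den z N v).
Proof.
move=> v1 N0; rewrite -{1}(ger0_norm N0) -normC_real -(normC_conjc z).
by rewrite -[normC (conjc z)]mulr1 -v1 -normCM le_normCB.
Qed.

(** For [v] of modulus 1 the numerator is [v] times the conjugate of the denominator. *)
Lemma disc_num_normC (z : R[i]) (N : R) v : normC v = 1 ->
  normC (z + N%:C * v) = normC (disc_den z N v).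
Proof.
move=> v1; apply/eqP; rewrite -(@eqrXn2 _ 2)// ?normC_ge0//; apply/eqP.
have : normC v ^+ 2 = 1 by rewrite v1 expr1n.
rewrite !normC_sqr; case: z => x y; case: v {v1} => p q; rewrite /disc_den/= => v1.
rewrite !mul0r !subr0 !addr0 !add0r.
transitivity (x ^+ 2 + y ^+ 2 + 2 * N * (x * p + y * q) +
  N ^+ 2 * (p ^+ 2 + q ^+ 2)); first by ring.
transitivity (N ^+ 2 + 2 * N * (x * p + y * q) +
  (x ^+ 2 + y ^+ 2) * (p ^+ 2 + q ^+ 2)); last by ring.
by rewrite v1 !mulr1; ring.
Qed.

Lemma disc_aut_normC (z : R[i]) (N : R) v : normC v = 1 -> normC z < N ->
  normC (disc_aut z N v) = 1.
Proof.
move=> v1 zN; have N0 : 0 <= N by exact: le_trans (normC_ge0 z) (ltW zN).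
have := disc_den_ge z v1 N0 => d0; have {}d0 : 0 < normC (disc_den z N v) by lra.
by rewrite /disc_aut normCM normCV disc_num_normC// divff// gt_eqF.
Qed.

(** The second factor on the right is the one by which the automorphism multiplies angular speed in
    [disc_aut_unwinding]. So the distance to the centre is controlled by the turning, which is
    bounded a priori. *)
Lemma disc_aut_center (z : R[i]) (N : R) v : normC v = 1 -> normC z < N ->
  normC (disc_aut z N v - z / N%:C) ^+ 2 =
  (N ^+ 2 - normC z ^+ 2) / N ^+ 2 *
  ((N ^+ 2 - normC z ^+ 2) / normC (disc_den z N v) ^+ 2).
Proof.
move=> v1 zN; have N0 : 0 < N by exact: le_lt_trans (normC_ge0 z) zN.
have := disc_den_ge z v1 (ltW N0) => d0; have {}d0 : 0 < normC (disc_den z N v) by lra.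
have D0 : disc_den z N v != 0 by apply: contraTneq d0 => ->; rewrite normC0 ltxx.
have NC0 : N%:C != 0 :> R[i] by rewrite fmorph_eq0 gt_eqF.
have -> : disc_aut z N v - z / N%:C =
    ((N ^+ 2 - normC z ^+ 2)%:C * v) / (N%:C * disc_den z N v).
  have -> : (N ^+ 2 - normC z ^+ 2)%:C = N%:C ^+ 2 - z * conjc z.
    rewrite normC_sqr; case: z {zN d0 D0} => x y; apply/eqP.
    rewrite eq_complex !expr2/=; apply/andP; split; apply/eqP; ring.
  rewrite /disc_aut; move: D0; rewrite /disc_den => D0.
  by field; rewrite NC0 D0.
rewrite normCM normCV !normCM v1 !normC_real.
rewrite mulr1 (gtr0_norm N0) expr_div_n exprMn.
have -> : `|N ^+ 2 - normC z ^+ 2| ^+ 2 = (N ^+ 2 - normC z ^+ 2) ^+ 2.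
  by rewrite real_normK ?num_real.
by field; rewrite !gt_eqF.
Qed.

(** The phase changes by minus twice the argument of the denominator. The denominator stays in the
    right half plane and returns to its initial value, so it does not wind around 0 and the total
    turning is unchanged. *)
Lemma disc_aut_unwinding k r (v : R -> R[i]) z N : unwinding k r v -> normC z < N ->
  unwinding k (fun t => r t * ((N ^+ 2 - normC z ^+ 2) / normC (disc_den z N (v t)) ^+ 2))
    (fun t => disc_aut z N (v t)).
Proof.
move=> [[v1 dp dq] sr r0 v01 [P [dP Pk]]] zN.
have N0 : 0 < N by exact: le_lt_trans (normC_ge0 z) zN.
pose x := complex.Re z; pose y := complex.Im z.
pose p t := complex.Re (v t); pose q t := complex.Im (v t).
pose W1 t := N + (x * p t + y * q t); pose W2 t := x * q t - y * p t.
pose D t := W1 t * W1 t + W2 t * W2 t.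
have pq t : p t ^+ 2 + q t ^+ 2 = 1 by rewrite -normC_sqr v1 expr1n.
have xyN : x ^+ 2 + y ^+ 2 = normC z ^+ 2 by rewrite normC_sqr.
(* Cauchy-Schwarz for [z] and the unit vector [v t], together with [normC z < N]. *)
have W10 t : 0 < W1 t.
  have : (x * p t + y * q t) ^+ 2 < N ^+ 2.
    apply: (@le_lt_trans _ _ (normC z ^+ 2)); last by rewrite ltr_pXn2r ?nnegrE ?normC_ge0// ltW.
    rewrite -xyN -[leRHS]mulr1 -(pq t) -subr_ge0.
    rewrite (_ : _ - _ = (x * q t - y * p t) ^+ 2); last by ring.
    exact: sqr_ge0.
  rewrite -real_normK ?num_real// ltr_pXn2r ?nnegrE ?(ltW N0)// ltr_norml /W1 => /andP[? _].
  lra.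
have denE t : disc_den z N (v t) = W1 t +i* W2 t.
  rewrite /disc_den /W1 /W2 /p /q /x /y; case: (z) => ? ?; case: (v t) => ? ?.
  by apply/eqP; rewrite eq_complex/=; apply/andP; split; apply/eqP; ring.
have DE t : normC (disc_den z N (v t)) ^+ 2 = D t by rewrite denE normC_sqr /D !expr2.
have D0 t : D t != 0.
  by rewrite gt_eqF// /D -!expr2 ltr_pwDl ?exprn_gt0// sqr_ge0.
have rE t : (2 * N * W1 t - D t) / D t = (N ^+ 2 - normC z ^+ 2) / D t.
  congr (_ / _); transitivity (N ^+ 2 - (x ^+ 2 + y ^+ 2) * (p t ^+ 2 + q t ^+ 2)).
    by rewrite /D /W1 /W2; ring.
  by rewrite pq mulr1 xyN.
pose a t := (p t * (W1 t * W1 t - W2 t * W2 t) +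
      (q t * (W1 t * W2 t) + q t * (W1 t * W2 t))) * (D t)^-1.
pose b t := (q t * (W1 t * W1 t - W2 t * W2 t) -
      (p t * (W1 t * W2 t) + p t * (W1 t * W2 t))) * (D t)^-1.
have fE t : disc_aut z N (v t) = a t +i* b t.
  have den0 : disc_den z N (v t) != 0.
    rewrite denE; apply: contra (D0 t); rewrite eq_complex/= => /andP[/eqP E1 /eqP E2].
    by rewrite /D E1 E2 mul0r addr0.
  apply: (mulIf den0); rewrite divfK// denE.
  have -> : z + N%:C * v t = (p t * W1 t + q t * W2 t) +i* (q t * W1 t - p t * W2 t).
    have : p t ^+ 2 + q t ^+ 2 = 1 by [].
    rewrite /W1 /W2 /p /q /x /y; case: (z) => x' y'; case: (v t) => p' q' /= pq'.
    apply/eqP; rewrite eq_complex/=; apply/andP; split; apply/eqP.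
      transitivity (x' * (p' ^+ 2 + q' ^+ 2) + N * p'); last by ring.
      by rewrite pq'; ring.
    transitivity (y' * (p' ^+ 2 + q' ^+ 2) + N * q'); last by ring.
    by rewrite pq'; ring.
  have := D0 t; rewrite /a /b /D => D0'.
  by apply/eqP; rewrite eq_complex/=; apply/andP; split; apply/eqP; field.
have dW1 (t : R) : is_derive t 1 W1 (- 1 * (r t * W2 t)).
  have H := is_derive_addf (is_derive_cst N t (1 : R))
    (is_derive_addf (is_derive_mulf (is_derive_cst x t (1 : R)) (dp t))
                    (is_derive_mulf (is_derive_cst y t (1 : R)) (dq t))).
  by apply: (is_derive_eq H); rewrite /W2 /p /q /=; ring.
have dW2 (t : R) : is_derive t 1 W2 (r t * (W1 t - N)).
  have H := (is_derive_subf (is_derive_mulf (is_derive_cst x t (1 : R)) (dq t))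
                    (is_derive_mulf (is_derive_cst y t (1 : R)) (dp t))).
  by apply: (is_derive_eq H); rewrite /W1 /p /q /=; ring.
have r'E : (fun t => r t * ((N ^+ 2 - normC z ^+ 2) / normC (disc_den z N (v t)) ^+ 2)) =
    (fun t => r t * ((2 * N * W1 t - D t) / D t)).
  by apply/funext => t; rewrite DE rE.
split.
- rewrite r'E; split=> t; first by rewrite disc_aut_normC.
  + rewrite (_ : (fun s => _) = a); last by apply/funext => s; rewrite fE.
    rewrite fE; exact: is_derive_quotient_Re (dp t) (dq t) (dW1 t) (dW2 t) (W10 t).
  + rewrite (_ : (fun s => _) = b); last by apply/funext => s; rewrite fE.
    rewrite fE; exact: is_derive_quotient_Im (dp t) (dq t) (dW1 t) (dW2 t) (W10 t).
- move=> m; have [Cp Cq] := Cn_rotation m sr dp dq.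
  have CW1 : Cn m W1.
    by apply: CnD; [exact: Cn_cst|apply: CnD; apply: CnM => //; exact: Cn_cst].
  have CW2 : Cn m W2.
    apply: CnD; first by apply: CnM => //; exact: Cn_cst.
    rewrite (_ : (fun t => - (y * p t)) = (fun t => - y * p t)).
      by apply: CnM => //; exact: Cn_cst.
    by apply/funext => t; rewrite mulNr.
  have CD : Cn m D by apply: CnD; exact: CnM.
  rewrite (_ : (fun t => _) = (fun t => r t * ((N ^+ 2 - normC z ^+ 2) * (D t)^-1))).
    apply: CnM; first exact: sr.
    by apply: CnM; [exact: Cn_cst|exact: CnV].
  by apply/funext => t; rewrite DE.
- move=> t; rewrite mulr_ge0// divr_ge0 ?exprn_ge0 ?normC_ge0// subr_ge0.
  by rewrite ler_pXn2r ?nnegrE ?normC_ge0 ?ltW.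
- by rewrite v01.
- exists (fun u => P u - 2 * atan (W2 u * (W1 u)^-1)); split.
    move=> t; rewrite DE -rE.
    by have H := is_derive_quotient_phase (dW1 t) (dW2 t) (W10 t) (dP t); exact: H.
  have -> : W1 1 = W1 0 by rewrite /W1 /p /q v01.
  have -> : W2 1 = W2 0 by rewrite /W2 /p /q v01.
  lra.
Qed.

End disc_automorphism.

(** * Schur's algorithm and its quantitative estimates *)

Section schur_functions.
Context {R : realType}.
Local Notation mu := (@lebesgue_measure R).
Local Open Scope complex_scope.
Implicit Types (f g : R -> R[i]) (z v : R[i]) (zs : seq R[i]).

Definition sqnormC zs : R := \sum_(z <- zs) normC z ^+ 2.

Definition l2norm zs : R := Num.sqrt (sqnormC zs).

(* Schur's algorithm run backwards: [schur zs] is a Blaschke product, and the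
   points [zs / l2norm zs] of the sphere are its rescaled Schur parameters. *)
Fixpoint schur zs (t : R) : R[i] :=
  if zs is z :: zs' then
    if sqnormC zs' == 0 then z / (l2norm zs)%:C
    else disc_aut z (l2norm zs) (unit_loop t * schur zs' t)
  else 1.

Lemma sqnormC_ge0 zs : 0 <= sqnormC zs.
Proof. by apply: sumr_ge0 => z _; exact: sqr_ge0. Qed.

Lemma sqnormC_cons z zs : sqnormC (z :: zs) = normC z ^+ 2 + sqnormC zs.
Proof. exact: big_cons. Qed.

Lemma sqr_l2norm zs : l2norm zs ^+ 2 = sqnormC zs.
Proof. by rewrite sqr_sqrtr// sqnormC_ge0. Qed.

Lemma l2norm_gt0 zs : sqnormC zs != 0 -> 0 < l2norm zs.
Proof. by move=> z0; rewrite sqrtr_gt0 lt_neqAle eq_sym z0 sqnormC_ge0. Qed.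

Lemma normC_lt_l2norm z zs : sqnormC zs != 0 -> normC z < l2norm (z :: zs).
Proof.
move=> z0; rewrite -(@ltr_pXn2r _ 2)// ?nnegrE ?normC_ge0 ?sqrtr_ge0//.
by rewrite sqr_l2norm sqnormC_cons ltrDl lt_neqAle eq_sym z0 sqnormC_ge0.
Qed.

Lemma l2norm_head z zs : sqnormC zs = 0 -> l2norm (z :: zs) = normC z.
Proof.
by move=> z0; rewrite /l2norm sqnormC_cons z0 addr0 sqrtr_sqr ger0_norm// normC_ge0.
Qed.

Lemma schur_tail0 z zs : sqnormC zs = 0 ->
  schur (z :: zs) = fun=> z / (l2norm (z :: zs))%:C.
Proof. by move=> z0; apply/funext => t /=; rewrite z0 eqxx. Qed.

Lemma schur_cons z zs : sqnormC zs != 0 ->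
  schur (z :: zs) = fun t => disc_aut z (l2norm (z :: zs)) (unit_loop t * schur zs t).
Proof. by move=> z0; apply/funext => t /=; rewrite (negPf z0). Qed.

(** Each step multiplies by [unit_loop], which adds one turn, and then applies a disc automorphism,
    which adds none. The innermost step is a constant; a vanishing tail only stops the algorithm
    earlier. *)
Lemma schur_unwinding zs : sqnormC zs != 0 ->
  exists r, unwinding (size zs).-1 r (schur zs).
Proof.
elim: zs => [|z zs IH]; first by rewrite /sqnormC big_nil eqxx.
have [z0 zz|z0 _] := eqVneq (sqnormC zs) 0.
  exists (fun=> 0); rewrite schur_tail0//; apply: (@unwinding_le _ 0) => //.
  apply: unwinding_cst.
  have := l2norm_gt0 zz; rewrite l2norm_head// => zgt0.
  by rewrite normCM normCV normC_real (gtr0_norm zgt0) divff// gt_eqF.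
have [r ur] := IH z0; rewrite schur_cons//.
have := disc_aut_unwinding (unwindingM unwinding_unit_loop ur) (normC_lt_l2norm z z0).
rewrite add1n prednK; last by case: (zs) z0 => //; rewrite /sqnormC big_nil eqxx.
by move=> u; eexists; exact: u.
Qed.

Lemma disc_autN z N v : disc_aut (- z) N (- v) = - disc_aut z N v.
Proof.
rewrite /disc_aut /disc_den mulrN -opprD mulNr; congr (- (_ / (_ + _))).
by case: z => x y; case: v => p q; apply/eqP; rewrite eq_complex/=;
  apply/andP; split; apply/eqP; ring.
Qed.

Lemma sqnormCN zs : sqnormC (map -%R zs) = sqnormC zs.
Proof.
by rewrite /sqnormC big_map; apply: eq_bigr => z _; rewrite [normC (- z)]normcN.
Qed.

Lemma schurN zs t : sqnormC zs != 0 -> schur (map -%R zs) t = - schur zs t.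
Proof.
elim: zs => [|z zs IH]; first by rewrite /sqnormC big_nil eqxx.
have lN : l2norm (map -%R (z :: zs)) = l2norm (z :: zs) by rewrite /l2norm sqnormCN.
move=> zz; rewrite -[map _ _]/(- z :: map -%R zs) in lN *.
rewrite /= sqnormCN lN; case: eqP => [_|/eqP z0]; first by rewrite mulNr.
by rewrite IH// mulrN disc_autN.
Qed.

Lemma unit_loop1 t : normC (unit_loop t : R[i]) = 1.
Proof. by have [[H _ _] _ _ _ _] := @unwinding_unit_loop R; exact: H. Qed.

Lemma schur1 zs t : sqnormC zs != 0 -> normC (schur zs t) = 1.
Proof. by move=> /schur_unwinding[r [[H _ _] _ _ _ _]]. Qed.

Lemma normC_dist_continuous f g :
  continuous (fun t => complex.Re (f t)) -> continuous (fun t => complex.Im (f t)) ->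
  continuous (fun t => complex.Re (g t)) -> continuous (fun t => complex.Im (g t)) ->
  continuous (fun t => normC (f t - g t)).
Proof.
move=> cRf cIf cRg cIg.
rewrite (_ : (fun t => _) = (fun t => Num.sqrt
  ((complex.Re (f t) - complex.Re (g t)) * (complex.Re (f t) - complex.Re (g t)) +
   (complex.Im (f t) - complex.Im (g t)) * (complex.Im (f t) - complex.Im (g t))))); last first.
  apply/funext => t; rewrite -ReB -ImB -!expr2 -normC_sqr sqrtr_sqr.
  by rewrite ger0_norm// normC_ge0.
move=> t; apply: (@continuous_comp _ _ _ (fun t =>
  ((complex.Re (f t) - complex.Re (g t)) * (complex.Re (f t) - complex.Re (g t)) +
   (complex.Im (f t) - complex.Im (g t)) * (complex.Im (f t) - complex.Im (g t)))) Num.sqrt);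
  last exact: sqrt_continuous.
have c1 : {for t, continuous (fun t => complex.Re (f t) - complex.Re (g t))}.
  by apply: cvgB; [exact: cRf|exact: cRg].
have c2 : {for t, continuous (fun t => complex.Im (f t) - complex.Im (g t))}.
  by apply: cvgB; [exact: cIf|exact: cIg].
by apply: cvgD; apply: cvgM.
Qed.

Lemma unwinding_continuous k r f : unwinding k r f ->
  continuous (fun t => complex.Re (f t)) /\ continuous (fun t => complex.Im (f t)).
Proof.
move=> [[_ dR dI] _ _ _ _].
by split=> t; [exact: is_derive_continuous (dR t)|exact: is_derive_continuous (dI t)].
Qed.

Lemma schur_dist_continuous zs ws : sqnormC zs != 0 -> sqnormC ws != 0 ->
  continuous (fun t => normC (schur zs t - schur ws t)).
Proof.
move=> /schur_unwinding[r /unwinding_continuous[h1 h2]].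
move=> /schur_unwinding[s /unwinding_continuous[h3 h4]].
exact: normC_dist_continuous.
Qed.

Lemma schur_cst_continuous zs (c : R[i]) : sqnormC zs != 0 ->
  continuous (fun t => normC (schur zs t - c)).
Proof.
move=> /schur_unwinding[r /unwinding_continuous[h1 h2]].
by apply: normC_dist_continuous => // t; exact: cvg_cst.
Qed.

Lemma Rintegral_affine_le (h g : R -> R) (a b : R) : continuous h -> continuous g ->
  (forall t, h t <= a + b * g t) ->
  \int[mu]_(t in `[0, 1]) h t <= a + b * \int[mu]_(t in `[0, 1]) g t.
Proof.
move=> ch cg hg; have cbg : continuous (fun t => b * g t).
  by move=> t; apply: cvgM; [exact: cvg_cst|exact: cg].
have ca : continuous (fun _ : R => a) by move=> t; exact: cvg_cst.
have cabg : continuous (fun t => a + b * g t).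
  by move=> t; apply: cvgD; [exact: ca|exact: cbg].
have I (f : R -> R) (cf : continuous f) := continuous_integrable 0 1 cf.
have -> : a = \int[mu]_(t in `[0, 1]) a.
  rewrite Rintegral_cst//= lebesgue_measure_itv/= lte_fin ltr01.
  by rewrite oppr0 adde0 mulr1.
rewrite -RintegralZl; [|by []|exact: I cg].
rewrite -RintegralD; [|by []|exact: I ca|exact: I cbg].
by apply: le_Rintegral; [by []|exact: I ch|exact: I cabg|].
Qed.

(** This handles the drop of degree: when the tail is small compared with the whole, [schur] is
    close in mean to its first parameter. The mean square deviation is bounded through
    [disc_aut_center] by the relative size of the tail times the number of turns; the free constant
    [c] converts this into a bound on the mean. *)
Lemma schur_near_head z zs (c : R) : sqnormC (z :: zs) != 0 -> 0 < c ->
  \int[mu]_(t in `[0, 1]) normC (schur (z :: zs) t - z / (l2norm (z :: zs))%:C) <=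
  c + sqnormC zs / l2norm (z :: zs) ^+ 2 / c * (size zs)%:R.
Proof.
move=> zz c0; have cc := @schur_cst_continuous (z :: zs) (z / (l2norm (z :: zs))%:C) zz.
have N0 := l2norm_gt0 zz; set N := l2norm (z :: zs) in N0 cc *.
have S0 := sqnormC_ge0 zs.
have [z0|z0] := eqVneq (sqnormC zs) 0.
  have E0 t : normC (schur (z :: zs) t - z / N%:C) = 0 by rewrite schur_tail0// subrr normC0.
  under eq_Rintegral do rewrite E0.
  rewrite Rintegral_cst//= mul0r; apply: addr_ge0; first exact: ltW.
  apply: mulr_ge0 => //; apply: divr_ge0; last exact: ltW.
  by apply: divr_ge0 => //; exact: sqr_ge0.
have zN := normC_lt_l2norm z z0; rewrite -/N in zN.
have [r ur] := schur_unwinding z0.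
have uv := unwindingM unwinding_unit_loop ur.
have [_ _ r0 _ _] := ur.
have [[v1 _ _] _ _ _ _] := uv.
have := disc_aut_unwinding uv zN; rewrite add1n prednK; last first.
  by case: (zs) z0 => //; rewrite /sqnormC big_nil eqxx.
set s := (fun t : R => _) => us.
have [_ ss s0 _ [P [dP Pk]]] := us.
have SE : N ^+ 2 - normC z ^+ 2 = sqnormC zs.
  by rewrite sqr_l2norm sqnormC_cons addrAC subrr add0r.
have pi0 := pi_gt0 R.
have N20 : 0 < N ^+ 2 by rewrite exprn_gt0.
set C := sqnormC zs / N ^+ 2 / c / (2 * pi).
have C0 : 0 <= C by rewrite !divr_ge0// ltW// mulr_gt0.
have E t : normC (schur (z :: zs) t - z / N%:C) <= c + C * s t.
  set A := normC _.
  (* The speed before the automorphism is [2 * pi + r], which is at least [2 * pi]; hence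
     [s t / (2 * pi)] dominates the last factor of [disc_aut_center]. *)
  have A2 : A ^+ 2 <= sqnormC zs / N ^+ 2 * (s t / (2 * pi)).
    rewrite /A schur_cons// disc_aut_center// -/N SE.
    apply: ler_wpM2l; first by rewrite divr_ge0 // ltW.
    rewrite /s SE ler_pdivlMr ?mulr_gt0// mulrC.
    apply: ler_wpM2r; last by rewrite lerDl r0.
    by apply: divr_ge0 => //; exact: sqr_ge0.
  have -> : C * s t = sqnormC zs / N ^+ 2 * (s t / (2 * pi)) / c.
    rewrite /C; move: (sqnormC zs / N ^+ 2) (2 * pi)^-1 (s t) c^-1 => x1 x2 x3 x4.
    ring.
  (* The inequality A <= c + A^2 / c replaces the Cauchy-Schwarz inequality for integrals. *)
  apply: (@le_trans _ _ (c + A ^+ 2 / c)); last by rewrite lerD2l ler_pM2r// invr_gt0.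
  rewrite -(ler_pM2r c0) mulrDl mulfVK ?gt_eqF//.
  have := sqr_ge0 (A - c); have : 0 <= A by exact: normC_ge0.
  rewrite sqrrB -!expr2 => ? ?; nra.
have cs : continuous s by move=> t; exact: (Cn_continuous (ss 0%N)).
apply: le_trans (Rintegral_affine_le cc cs E) _.
have -> : \int[mu]_(t in `[0, 1]) s t = P 1 - P 0.
  apply: (Rintegral_primitive (P := setT) cs _ ltr01) => // t _; exact: dP.
rewrite lerD2l.
have -> : sqnormC zs / N ^+ 2 / c * (size zs)%:R = C * (2 * pi * (size zs)%:R).
  by rewrite /C mulrA mulfVK// gt_eqF// mulr_gt0.
exact: ler_wpM2l.
Qed.

(** In the identity [E] the moving denominator is absorbed into a value of modulus 1, so only the
    denominator at [z0], [N0], [v0] is left to bound from below. The constants therefore depend on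
    the limit data alone. *)
Lemma disc_aut_dist z N v z0 N0 v0 : normC v = 1 -> normC v0 = 1 ->
  normC z < N -> normC z0 < N0 ->
  normC (disc_aut z N v - disc_aut z0 N0 v0) <=
  2 * (normC (z - z0) + `|N - N0|) / (N0 - normC z0) +
  2 * N0 / (N0 - normC z0) * normC (v - v0).
Proof.
move=> v1 v01 zN zN0.
have Nge0 : 0 <= N by exact: le_trans (normC_ge0 z) (ltW zN).
have N0ge0 : 0 <= N0 by exact: le_trans (normC_ge0 z0) (ltW zN0).
have d0 : 0 < normC (disc_den z N v).
  by apply: lt_le_trans (disc_den_ge _ v1 Nge0); rewrite subr_gt0.
have g0 : 0 < N0 - normC z0 by rewrite subr_gt0.
have d0g := disc_den_ge z0 v01 N0ge0.
have d00 : 0 < normC (disc_den z0 N0 v0) by exact: lt_le_trans g0 d0g.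
have D0 : disc_den z N v != 0 by apply: contraTneq d0 => ->; rewrite normC0 ltxx.
have D00 : disc_den z0 N0 v0 != 0 by apply: contraTneq d00 => ->; rewrite normC0 ltxx.
set A := z + N%:C * v; set A0 := z0 + N0%:C * v0.
have E : disc_aut z N v - disc_aut z0 N0 v0 =
    ((disc_den z0 N0 v0 - disc_den z N v) * disc_aut z N v + (A - A0)) / disc_den z0 N0 v0.
  rewrite /disc_aut -/A -/A0; move: D0 D00.
  by move: (disc_den z N v) (disc_den z0 N0 v0) => d d' h h'; field; rewrite h h'.
rewrite E normCM normCV.
set X := _ + _; set B := normC (z - z0) + `|N - N0| + N0 * normC (v - v0).
have HB1 : normC (A - A0) <= B.
  have -> : A - A0 = (z - z0) + ((N - N0)%:C * v + N0%:C * (v - v0)).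
    by rewrite /A /A0 rmorphB/=; ring.
  apply: le_trans (le_normcD _ _) _; rewrite /B -addrA lerD2l.
  apply: le_trans (le_normcD _ _) _; rewrite -!/(normC _).
  by rewrite !normCM v1 mulr1 !normC_real (ger0_norm N0ge0).
have HB2 : normC (disc_den z0 N0 v0 - disc_den z N v) <= B.
  rewrite normC_dist.
  have -> : disc_den z N v - disc_den z0 N0 v0 =
      (N - N0)%:C + (conjc (z - z0) * v + conjc z0 * (v - v0)).
    by rewrite /disc_den !rmorphB/=; ring.
  apply: le_trans (le_normcD _ _) _; rewrite /B -!/(normC _).
  rewrite [X in _ <= X + _]addrC -addrA normC_real lerD2l.
  apply: le_trans (le_normcD _ _) _; rewrite -!/(normC _).
  rewrite !normCM v1 mulr1 !normC_conjc lerD2l.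
  by rewrite ler_wpM2r// ?normC_ge0// ltW.
have HX : normC X <= 2 * B.
  apply: le_trans (le_normcD _ _) _; rewrite -!/(normC _).
  by rewrite normCM disc_aut_normC// mulr1; lra.
have X0 := normC_ge0 X.
apply: (@le_trans _ _ (2 * B / (N0 - normC z0))).
  apply: ler_pM => //; first by rewrite invr_ge0 ltW.
  by rewrite lef_pV2.
rewrite /B le_eqVlt; apply/orP; left; apply/eqP; field; lra.
Qed.

End schur_functions.

(** * L^1 continuity of Schur's algorithm *)

Section schur_continuity.
Context {R : realType}.
Local Notation mu := (@lebesgue_measure R).
Local Open Scope complex_scope.

Definition l1dist (f g : R -> R[i]) : R :=
  \int[mu]_(t in `[0, 1]) normC (f t - g t).

Variables (T : Type) (F : set_system T) (zeta : nat -> T -> R[i]) (zeta0 : nat -> R[i]).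
Context {FF : Filter F}.
Hypothesis zeta_cvg : forall j (e : R), 0 < e ->
  \forall x \near F, normC (zeta j x - zeta0 j) < e.

Let Z m k x := [seq zeta j x | j <- iota m k].
Let Z0 m k := [seq zeta0 j | j <- iota m k].

Lemma sqnormC_cvg m k : sqnormC (Z m k x) @[x --> F] --> sqnormC (Z0 m k).
Proof.
elim: k m => [|k IH] m.
  under eq_cvg do rewrite /Z/= /sqnormC big_nil.
  by rewrite /Z0/= /sqnormC big_nil; exact: cvg_cst.
under eq_cvg do rewrite [Z _ _ _]/= sqnormC_cons expr2.
rewrite [Z0 _ _]/= sqnormC_cons expr2.
have H : normC (zeta m x) @[x --> F] --> normC (zeta0 m).
  apply/cvgrPdist_lt => e e0; apply: filterS (zeta_cvg m e0) => x.
  by apply: le_lt_trans; rewrite distrC normC_lip.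
by apply: cvgD; [exact: cvgM|exact: IH].
Qed.

Lemma l2norm_cvg m k : l2norm (Z m k x) @[x --> F] --> l2norm (Z0 m k).
Proof.
apply: continuous_cvg; last exact: sqnormC_cvg.
exact: sqrt_continuous.
Qed.

Lemma sqnormC_near_neq0 m k : sqnormC (Z0 m k) != 0 ->
  \forall x \near F, sqnormC (Z m k x) != 0.
Proof.
move=> z0.
have Z00 : 0 < sqnormC (Z0 m k) by rewrite lt_neqAle eq_sym z0 sqnormC_ge0.
have /cvgrPdist_lt/(_ _ Z00) := @sqnormC_cvg m k.
apply: filterS => x; apply: contraTneq => ->.
by rewrite subr0 gtr0_norm// ltxx.
Qed.

(** Induction on the length. If the limit of the tail is nonzero, the automorphisms converge
    uniformly and [disc_aut_dist] passes the convergence on. If it is zero, the induction hypothesis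
    says nothing about the tail, but the limit is constant and [schur_near_head] applies. *)
Lemma schur_cvg m k : sqnormC (Z0 m k) != 0 -> forall e : R, 0 < e ->
  \forall x \near F, sqnormC (Z m k x) != 0 /\
    l1dist (schur (Z m k x)) (schur (Z0 m k)) < e.
Proof.
elim: k m => [|k IH] m; first by rewrite /sqnormC big_nil eqxx.
move=> ZZ e e0; have nZ := sqnormC_near_neq0 ZZ.
have N0 := l2norm_gt0 ZZ; set N := l2norm (Z0 m k.+1) in N0.
have Ncvg (d : R) : 0 < d -> \forall x \near F, `|l2norm (Z m k.+1 x) - N| < d.
  move=> d0; have /cvgrPdist_lt/(_ _ d0) := @l2norm_cvg m k.+1.
  by apply: filterS => x; rewrite distrC.
have ZE x : Z m k.+1 x = zeta m x :: Z m.+1 k x by [].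
have Z0E : Z0 m k.+1 = zeta0 m :: Z0 m.+1 k by [].
have [z0|z0] := eqVneq (sqnormC (Z0 m.+1 k)) 0.
  (* The first bound keeps the nearby norm above [N / 2]; the second makes the two constants differ
     by less than [e / 4]. *)
  pose d := Num.min (N / 2) (e * N / 8).
  have d0 : 0 < d by rewrite lt_min !divr_gt0// mulr_gt0.
  have k0 : 0 < k.+1%:R :> R by rewrite ltr0n.
  (* Solves [d' * k.+1 = e / 4 * ((N / 2) ^+ 2 * (e / 4))], so that the tail term of
     [schur_near_head] with [c = e / 4] is at most [e / 4]. The successor avoids a division by zero
     at [k = 0]. *)
  pose d' := N ^+ 2 * e ^+ 2 / (64 * k.+1%:R).
  have d'0 : 0 < d' by rewrite divr_gt0 ?mulr_gt0 ?exprn_gt0.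
  have tailcvg : \forall x \near F, sqnormC (Z m.+1 k x) < d'.
    have /cvgrPdist_lt/(_ _ d'0) := @sqnormC_cvg m.+1 k.
    by apply: filterS => x; rewrite z0 sub0r normrN ger0_norm// sqnormC_ge0.
  near=> x.
  have nx : sqnormC (Z m k.+1 x) != 0 by near: x.
  have dN : `|l2norm (Z m k.+1 x) - N| < d by near: x; exact: Ncvg.
  have dz : normC (zeta m x - zeta0 m) < d by near: x; exact: zeta_cvg.
  have dt : sqnormC (Z m.+1 k x) < d' by near: x.
  split => //.
  set c := zeta m x / (l2norm (Z m k.+1 x))%:C.
  set c0 := zeta0 m / N%:C.
  set M := l2norm (Z m k.+1 x) in c dN *.
  have M0 : 0 < M by exact: l2norm_gt0.
  have MN : N / 2 < M.
    have : `|M - N| < N / 2 by apply: lt_le_trans dN _; rewrite ge_min lexx.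
    by rewrite ltr_norml => /andP[? ?]; lra.
  have dcc : normC (c - c0) <= (normC (zeta m x - zeta0 m) + `|M - N|) / N.
    have -> : c - c0 = ((zeta m x - zeta0 m) + c * (N - M)%:C) / N%:C.
      rewrite /c /c0 -/M rmorphB/=.
      have NC0 : N%:C != 0 :> R[i] by rewrite fmorph_eq0 gt_eqF.
      have MC0 : M%:C != 0 :> R[i] by rewrite fmorph_eq0 gt_eqF.
      by field; rewrite NC0 MC0.
    rewrite normCM normCV !normC_real (gtr0_norm N0) ler_pM2r ?invr_gt0//.
    apply: le_trans (le_normcD _ _) _; rewrite -!/(normC _) lerD2l normCM normC_real distrC.
    apply: ler_piMl => //.
    rewrite normCM normCV normC_real gtr0_norm// ler_pdivrMr// mul1r.
    rewrite -(@ler_pXn2r _ 2)// ?nnegrE ?normC_ge0 ?(ltW M0)//.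
    by rewrite sqr_l2norm ZE sqnormC_cons lerDl sqnormC_ge0.
  have H1 : l1dist (schur (Z m k.+1 x)) (schur (Z0 m k.+1)) <=
      normC (c - c0) + 1 * \int[mu]_(t in `[0, 1]) normC (schur (Z m k.+1 x) t - c).
    apply: Rintegral_affine_le.
    - exact: schur_dist_continuous.
    - exact: schur_cst_continuous.
    - move=> t; rewrite Z0E schur_tail0// -Z0E -/N -/c0 mul1r.
      have -> : schur (Z m k.+1 x) t - c0 = (c - c0) + (schur (Z m k.+1 x) t - c) by ring.
      exact: le_normcD.
  have e40 : 0 < e / 4 by rewrite divr_gt0.
  have nx' := nx; rewrite ZE in nx'.
  have := schur_near_head nx' e40; rewrite -ZE -/M -/c => H2.
  have H3 : sqnormC (Z m.+1 k x) / M ^+ 2 / (e / 4) * (size (Z m.+1 k x))%:R <= e / 4.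
    rewrite size_map size_iota.
    rewrite -[_ / (e / 4)]mulrA -invfM mulrAC ler_pdivrMr; last by rewrite mulr_gt0// exprn_gt0.
    have H4 : sqnormC (Z m.+1 k x) * k%:R <= d' * k.+1%:R.
      by apply: ler_pM => //; [exact: sqnormC_ge0|exact: ltW|rewrite ler_nat].
    apply: le_trans H4 _.
    have -> : d' * k.+1%:R = e / 4 * ((N / 2) ^+ 2 * (e / 4)).
      by rewrite /d'; move: (k.+1%:R : R) k0 => kk kk0; field; rewrite gt_eqF.
    apply: ler_wpM2l; first exact: ltW.
    apply: ler_wpM2r; first exact: ltW.
    by rewrite ler_pXn2r// ?nnegrE ?ltW// divr_gt0.
  have H4 : (normC (zeta m x - zeta0 m) + `|M - N|) / N < e / 4.
    rewrite ltr_pdivrMr//.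
    have : d <= e * N / 8 by rewrite ge_min lexx orbT.
    lra.
  lra.
set G := N - normC (zeta0 m).
have G0 : 0 < G by rewrite subr_gt0; exact: normC_lt_l2norm.
(* Chosen so that the bound of [disc_aut_dist], with each of the three distances replaced by [d],
   equals [e / 2]. *)
pose d := e * G / (8 + 4 * N).
have q0 : 0 < 8 + 4 * N by lra.
have d0 : 0 < d by rewrite divr_gt0// mulr_gt0.
near=> x.
have nx : sqnormC (Z m k.+1 x) != 0 by near: x.
have dN : `|l2norm (Z m k.+1 x) - N| < d by near: x; exact: Ncvg.
have dz : normC (zeta m x - zeta0 m) < d by near: x; exact: zeta_cvg.
have [nt dt] : sqnormC (Z m.+1 k x) != 0 /\
    l1dist (schur (Z m.+1 k x)) (schur (Z0 m.+1 k)) < d by near: x; exact: IH.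
split => //.
have H1 : l1dist (schur (Z m k.+1 x)) (schur (Z0 m k.+1)) <=
    2 * (normC (zeta m x - zeta0 m) + `|l2norm (Z m k.+1 x) - N|) / G +
    2 * N / G * l1dist (schur (Z m.+1 k x)) (schur (Z0 m.+1 k)).
  apply: Rintegral_affine_le.
  - exact: schur_dist_continuous.
  - exact: schur_dist_continuous.
  - move=> t; rewrite ZE Z0E !schur_cons// -ZE -Z0E.
    have -> : normC (schur (Z m.+1 k x) t - schur (Z0 m.+1 k) t) =
        normC (unit_loop t * schur (Z m.+1 k x) t - unit_loop t * schur (Z0 m.+1 k) t).
      by rewrite -mulrBr normCM unit_loop1 mul1r.
    apply: disc_aut_dist.
    - by rewrite normCM unit_loop1 schur1// mulr1.
    - by rewrite normCM unit_loop1 schur1// mulr1.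
    - exact: normC_lt_l2norm.
    - exact: normC_lt_l2norm.
apply: le_lt_trans H1 _.
apply: (@le_lt_trans _ _ (2 * (d + d) / G + 2 * N / G * d)).
  apply: lerD.
    by rewrite ler_pM2r ?invr_gt0// ler_pM2l// lerD// ltW.
  by apply: ler_wpM2l; [rewrite divr_ge0 ?mulr_ge0// ltW|exact: ltW].
have -> : 2 * (d + d) / G + 2 * N / G * d = e / 2.
  by rewrite /d; field; rewrite !gt_eqF.
by rewrite ltr_pdivrMr// ltr_pMr// ltr1n.
Unshelve. all: by end_near. Qed.

End schur_continuity.

(** * The equivariant map from the n-sphere and the lower bound *)

Section sphere_into_Y.
Context {R : realType}.
Local Notation mu := (@lebesgue_measure R).
Local Open Scope complex_scope.

Lemma Y_of_unwinding n k r (f : R -> R[i]) : unwinding k r f -> (2 * k <= n)%N ->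
  exists y : Y R n, Yfun y = restrict01 f.
Proof.
move=> [[f1 dRe dIm] sr r0 _ [P [dP Pk]]] kn.
have fE : f = fun t => complex.Re (f t) +i* complex.Im (f t).
  by apply/funext => t; case: (f t).
have sm : smooth01 (restrict01 f).
  rewrite fE; apply: restrict01_smooth => m; have [C1 C2] := Cn_rotation m sr dRe dIm => //.
have dE : deriv01 (restrict01 f) =
    restrict01 (fun t => (- 1 * (r t * complex.Im (f t))) +i* (r t * complex.Re (f t))).
  by rewrite {1}fE; have [_ ->] := restrict01_derive dRe dIm.
(* Nonnegativity of the speed enters here: the modulus of the derivative is [r t] itself, whose
   integral is the total turning. *)
have dN t : normC ((- 1 * (r t * complex.Im (f t))) +i* (r t * complex.Re (f t))) = r t.
  apply/eqP; rewrite -(@eqrXn2 _ 2)// ?normC_ge0// normC_sqr/=.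
  rewrite (_ : _ + _ = r t ^+ 2 * (complex.Re (f t) ^+ 2 + complex.Im (f t) ^+ 2)); last by ring.
  by rewrite -normC_sqr f1 expr1n mulr1.
have c1 s : normC (restrict01 f s) = 1 by exact: f1.
have bnd : (W11norm (restrict01 f) <= (1 + pi * n%:R)%:E)%E.
  rewrite /W11norm L1norm_unit// EFinD leeD2lE// L1normE dE.
  have cr : continuous r by exact: (sr 0%N).
  have -> : (\int[mu]_(t in `[0%R, 1%R]) (normC (restrict01 (fun t =>
      (- 1 * (r t * complex.Im (f t))) +i* (r t * complex.Re (f t))) (proj01 t)))%:E =
      \int[mu]_(t in `[0%R, 1%R]) (r t)%:E)%E.
    by apply: eq_integral => t /set_mem t01; rewrite /restrict01 dN val_proj01.
  rewrite (integral_primitive (P := setT) (F := P) cr _ ltr01)// lee_fin.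
  apply: le_trans Pk _; rewrite mulrC mulrA mulrC ler_wpM2l ?pi_ge0//.
  by rewrite mulrC -natrM ler_nat.
by exists (MkY c1 sm bnd).
Qed.

Lemma L1dist_restrict01 n (y y' : Y R n) (f g : R -> R[i]) :
  Yfun y = restrict01 f -> Yfun y' = restrict01 g -> L1dist y y' = l1dist f g.
Proof.
move=> yf yg; rewrite L1distE yf yg; apply: eq_Rintegral => t /set_mem t01.
by rewrite /restrict01 val_proj01.
Qed.

Variable n : nat.

(** Padding by zero: for even [n] the [n.+1] real coordinates do not fill the [n./2.+1] complex
    ones, and the last imaginary part is set to 0. *)
Definition coordinate (x : sphere R n) (i : nat) : R :=
  if (i <= n)%N then val x 0 (inord i) else 0.

Definition complex_coordinate (j : nat) (x : sphere R n) : R[i] :=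
  coordinate x j.*2 +i* coordinate x j.*2.+1.

Definition complex_coordinates (x : sphere R n) : seq R[i] :=
  [seq complex_coordinate j x | j <- iota 0 n./2.+1].

Lemma complex_coordinates_neq0 x : sqnormC (complex_coordinates x) != 0.
Proof.
apply/negP => /eqP H.
have Hz j : (j < n./2.+1)%N -> complex_coordinate j x = 0.
  move=> jn; apply: ComplexField.Normc.eq0_normc; apply/eqP.
  move/eqP: H; rewrite /sqnormC big_map psumr_eq0; last by move=> i _; exact: sqr_ge0.
  by move=> /allP/(_ j); rewrite mem_iota/= jn => /(_ isT); rewrite sqrf_eq0.
have Hc i : val x 0 i = 0.
  have ni : (i <= n)%N by rewrite -ltnS.
  have i2n : (i./2 < n./2.+1)%N by rewrite ltnS half_leq.
  have /eqP := Hz _ i2n; rewrite eq_complex/= => /andP[/eqP + /eqP].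
  have := odd_double_half i; case: (odd i) => /= iE; rewrite /coordinate.
    by move=> _; rewrite -[(_./2).*2.+1]add1n iE ni inord_val.
  by rewrite add0n in iE; rewrite iE ni inord_val.
have := set_valP x; rewrite /sphere/= big1 => [/esym/eqP|i _]; first by rewrite oner_eq0.
by rewrite [val x _ _]Hc expr0n.
Qed.

Lemma complex_coordinatesN x :
  complex_coordinates (antipode x) = map -%R (complex_coordinates x).
Proof.
rewrite /complex_coordinates -map_comp; apply: eq_map => j /=.
rewrite /complex_coordinate /coordinate; apply/eqP; rewrite eq_complex/=.
by do 2 case: ifP; rewrite ?mxE ?oppr0 ?eqxx.
Qed.

Lemma normr_coord m (v : 'rV[R]_m) i : `|v 0 i| <= `|v|.
Proof.
rewrite [leRHS]/Num.norm/= mx_normrE.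
exact: (le_bigmax _ (fun ij => `|v ij.1 ij.2|) (0, i)).
Qed.

Lemma complex_coordinate_cvg x j (e : R) : 0 < e ->
  \forall y \near x, normC (complex_coordinate j y - complex_coordinate j x) < e.
Proof.
move=> e0; have e20 : 0 < e / 2 by rewrite divr_gt0.
apply/nbhs_ballP; exists (e / 2) => // y xy.
have {}xy : `|val x - val y| < e / 2.
  have : ball (val x) (e / 2) (val y) by [].
  by rewrite -ball_normE.
have H i : `|coordinate y i - coordinate x i| < e / 2.
  rewrite /coordinate; case: ifP => _; last by rewrite subrr normr0.
  apply: le_lt_trans xy; rewrite distrC.
  by have := normr_coord (val x - val y) (inord i); rewrite !mxE.
apply: le_lt_trans (normC_ReIm _) _; rewrite ReB ImB/= (splitr e).
by rewrite ltrD.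
Qed.

Lemma equivariant_sphere_Y : equivariant_from_sphere R (Yopp R n) n.
Proof.
have /choice[F FE] : forall x : sphere R n, exists y : Y R n,
    Yfun y = restrict01 (schur (complex_coordinates x)).
  move=> x; have [r ur] := schur_unwinding (complex_coordinates_neq0 x).
  apply: Y_of_unwinding ur _; rewrite size_map size_iota/= mul2n.
  by rewrite -[leqRHS]odd_double_half leq_addl.
exists F; split=> [x|x]; last first.
  apply: Y_inj; rewrite [LHS]FE complex_coordinatesN; apply/funext => s.
  rewrite [RHS]/= FE /restrict01 schurN//; exact: complex_coordinates_neq0.
move=> A /nbhs_ballP[e /= e0 eA].
have := schur_cvg (F := nbhs x) (zeta := complex_coordinate)
  (zeta0 := fun j => complex_coordinate j x) (fun j => @complex_coordinate_cvg x j)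
  (m := 0%N) (k := n./2.+1) (complex_coordinates_neq0 x) e0.
move=> /(_ (nbhs_filter x)); apply: (@filterS _ (nbhs x) (nbhs_filter x)) => y [_ xy].
apply: eA.
suff : L1dist (F x) (F y) < e by [].
by rewrite L1dist_sym (L1dist_restrict01 (FE y) (FE x)).
Qed.

End sphere_into_Y.

Theorem theorem6p2 (R : realType) (n : nat) (n_ge1 : (1 <= n)%N) :
  exists m : nat, is_coind R (Y R n) (Yopp R n) m /\ (n <= m <= 2 * n - 1)%N.
Proof.
pose P k := `[< equivariant_from_sphere R (Yopp R n) k >].
have Pn : P n by apply/asboolP; exact: equivariant_sphere_Y.
have Pub k : P k -> (k <= 2 * n - 1)%N.
  by move=> /asboolP; exact: equivariant_sphere_le.
have [m Pm mmax] := ex_maxnP (ex_intro _ n Pn) Pub.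
exists m; split; last by rewrite mmax// Pub.
by split=> [|k /asboolP/mmax]; first exact/asboolP.
Qed.
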